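(* Let $C:f=0$ be a reduced curve of degree $d$ in $X=\mathbb{P}^2$ over $\mathbb{C}$, with $r=\mathrm{mdr}(f)\ge 1$. If $r<d/2$ and $L_0:\alpha_{L_0}=0$ is a generic line in $X$, then the morphism $$N(f)_p\xrightarrow{\ \cdot\alpha_{L_0}^{q-p}\ }N(f)_q,$$ induced by the multiplication by $\alpha_{L_0}^{q-p}$, is an isomorphism for any integers $p,q$ with $d+r-3\le p<q\le 2d-r-3$.
   Context: $S=\mathbb{C}[x,y,z]$ with the usual grading; $f\in S_d$ is the reduced homogeneous equation of $C$; $f_x,f_y,f_z$ are its partial derivatives. $AR(f)_k=\{(a,b,c)\in S_k^3: af_x+bf_y+cf_z=0\}$ and $\mathrm{mdr}(f)=\min\{k: AR(f)_k\neq 0\}$. $J_f=(f_x,f_y,f_z)$ is the Jacobian ideal, $\widehat{J}_f$ its saturation with respect to $(x,y,z)$, and $N(f)=\widehat{J}_f/J_f$ the graded Jacobian module. ''Generic line'' means a line in a suitable nonempty Zariski open subset of the dual plane $\mathbb{P}(S_1)$ of all lines. *)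

(* Defs.v *)
From HB Require Import structures.
From mathcomp Require Import all_boot all_order all_algebra.
From mathcomp Require Import complex mpoly.
From mathcomp Require Import boolp classical_sets functions reals.

Set Implicit Arguments.
Unset Strict Implicit.
Unset Printing Implicit Defensive.

Import GRing.Theory.
Local Open Scope ring_scope.
Local Open Scope quotient_scope.
Local Open Scope classical_set_scope.

(* [Quotient.quot] only provides the additive structure of V / W. *)
Section LmodQuotient.
Variables (A : pzRingType) (V : lmodType A) (W : submodClosed V).

Definition submod_pred : {pred V} := W.

Fact submod_pred_zmod : zmod_closed submod_pred.
Proof. exact: GRing.submod_closedB (GRing.submodClosedP W). Qed.

HB.instance Definition _ := GRing.isZmodClosed.Build V submod_pred
  submod_pred_zmod.

Definition lmod_quot : Type := Quotient.quot submod_pred.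
HB.instance Definition _ := GRing.Zmodule.on lmod_quot.
HB.instance Definition _ := EqQuotient.on lmod_quot.

Definition lmod_quot_scale (a : A) (x : lmod_quot) : lmod_quot :=
  \pi_lmod_quot (a *: repr x).

Lemma lmod_quot_piP (x y : V) :
  (\pi_lmod_quot x = \pi_lmod_quot y) <-> x - y \in W.
Proof.
have -> : (x - y \in W) = (\pi_lmod_quot x == \pi_lmod_quot y).
  exact: (Quotient.idealrBE submod_pred x y).
by split=> /eqP.
Qed.

Lemma lmod_quot_piD (x y : V) :
  \pi_lmod_quot (x + y) = \pi_lmod_quot x + \pi_lmod_quot y.
Proof. exact: (raddfD (\pi_(Quotient.quot submod_pred))). Qed.

Lemma lmod_quot_piZ (a : A) (x : V) :
  \pi_lmod_quot (a *: x) = lmod_quot_scale a (\pi_lmod_quot x).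
Proof.
apply/lmod_quot_piP; rewrite -scalerBr; apply: rpredZ.
by apply/lmod_quot_piP; rewrite reprK.
Qed.

Fact lmod_quot_scaleA a b x :
  lmod_quot_scale a (lmod_quot_scale b x) = lmod_quot_scale (a * b) x.
Proof.
by rewrite -[x]reprK -(lmod_quot_piZ b) -(lmod_quot_piZ a) scalerA
  lmod_quot_piZ. Qed.

Fact lmod_quot_scale1 : left_id 1 lmod_quot_scale.
Proof. by move=> x; rewrite -[x]reprK -lmod_quot_piZ scale1r. Qed.

Fact lmod_quot_scaleDr : right_distributive lmod_quot_scale +%R.
Proof.
move=> a x y; rewrite -[x]reprK -[y]reprK.
by rewrite -lmod_quot_piD -!lmod_quot_piZ scalerDr lmod_quot_piD.
Qed.

Fact lmod_quot_scaleDl x : {morph lmod_quot_scale^~ x : a b / a + b}.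
Proof.
by move=> a b; rewrite -[x]reprK -!lmod_quot_piZ scalerDl lmod_quot_piD.
Qed.

HB.instance Definition _ := GRing.Zmodule_isLmodule.Build A lmod_quot
  lmod_quot_scaleA lmod_quot_scale1 lmod_quot_scaleDr lmod_quot_scaleDl.

End LmodQuotient.

Section PlaneCurve.
Variable K : fieldType.
Local Notation S := {mpoly K[3]}.
Implicit Types (f : S) (k p r : nat).

Definition reduced_poly f : Prop :=
  f != 0 /\ forall g h : S, f = g ^+ 2 * h -> (msize g <= 1)%N.

Definition AR f k : set ('I_3 -> S) :=
  [set a | (forall i, a i \is k.-homog) /\ \sum_(i < 3) a i * f^`M(i) = 0].

Definition is_mdr f r : Prop :=
  (exists2 a, AR f r a & exists i, a i != 0) /\
  forall k, (exists2 a, AR f k a & exists i, a i != 0) -> (r <= k)%N.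

Definition jacobian_ideal f : {pred S} :=
  fun g => `[< exists a : 'I_3 -> S, g = \sum_(i < 3) a i * f^`M(i) >].

(* I : (x, y, z)^oo; the monomials of degree k generate (x, y, z)^k. *)
Definition saturation (I : {pred S}) : {pred S} :=
  fun g => `[< exists k, forall m : 'X_{1..3},
                 mdeg m = k -> 'X_[m] * g \in I >].

(* Ideals of S are handled as submodules of the S-module S^o. *)
Definition jacobian_sat f : {pred S^o} := saturation (jacobian_ideal f).

Lemma jacobian_idealP f : submod_closed (jacobian_ideal f : {pred S^o}).
Proof.
split=> [|a g h /asboolP[u ->] /asboolP[v ->]]; apply/asboolP.
  by exists (fun=> 0); rewrite big1 // => i _; rewrite mul0r.
exists (fun i => a * u i + v i).
rewrite /GRing.scale/= mulr_sumr -big_split /=.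
by apply: eq_bigr => i _; rewrite mulrDl mulrA.
Qed.

Lemma jacobian_satP f : submod_closed (jacobian_sat f).
Proof.
have [J0 Jlin] := jacobian_idealP f.
split=> [|a g h /asboolP[k gk] /asboolP[l hl]]; apply/asboolP.
  by exists 0%N => m _; rewrite mulr0.
have JM b u : u \in jacobian_ideal f -> b * u \in jacobian_ideal f.
  by move=> uJ; have := Jlin b u 0 uJ J0; rewrite addr0.
have split_mon (e : nat) (m : 'X_{1..3}) : (e <= mdeg m)%N ->
    exists m1 m2 : 'X_{1..3}, mdeg m1 = e /\ m = (m1 + m2)%MM.
  elim: e m => [|e IH] m em; first by exists 0%MM, m; rewrite mdeg0 add0m.
  have [m1 [m2 [m1e mE]]] := IH m (ltnW em).
  have m2n0 : m2 <> 0%MM.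
    move=> m20; move: em.
    by rewrite mE m20 mdegD mdeg0 m1e addn0 ltnn.
  have [i mi] : exists i, m2 i != 0%N.
    apply: contrapT => h0; apply: m2n0; apply/mnmP => i; rewrite mnm0E.
    by apply/eqP; apply: contrapT => /negP hi; apply: h0; exists i.
  exists (m1 + U_(i))%MM, (m2 - U_(i))%MM.
  split; first by rewrite mdegD m1e mdeg1 addn1.
  by rewrite mE -addmA [(U_(i) + _)%MM]addmC submK // lep1mP.
have lift e e' (u : S) : (forall m : 'X_{1..3}, mdeg m = e ->
      'X_[m] * u \in jacobian_ideal f) ->
    forall m : 'X_{1..3}, mdeg m = (e + e')%N ->
      'X_[m] * u \in jacobian_ideal f.
  move=> ue m mE; have [|m1 [m2 [m1e ->]]] := split_mon e m.
    by rewrite mE leq_addr.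
  by rewrite mpolyXD ['X_[m1] * _]mulrC -mulrA; apply: JM; apply: ue.
exists (k + l)%N => m mE.
rewrite mulrDr mulrCA; apply: Jlin; first exact: lift gk _ mE.
by apply: lift hl _ _; rewrite addnC in mE; exact: mE.
Qed.

HB.instance Definition _ f :=
  GRing.isSubmodClosed.Build S S^o (jacobian_sat f)
    (GRing.submod_closed_semi (jacobian_satP f)).

Definition jacobian_sat_module f : Type := {g : S^o | g \in jacobian_sat f}.

HB.instance Definition _ f := Choice.on (jacobian_sat_module f).
HB.instance Definition _ f := SubType.on (jacobian_sat_module f).
HB.instance Definition _ f :=
  [SubChoice_isSubLmodule of jacobian_sat_module f by <:].

Definition jacobian_in_sat f : {pred jacobian_sat_module f} :=
  fun g => val g \in jacobian_ideal f.
Arguments jacobian_in_sat : clear implicits.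

Lemma jacobian_in_satP f : submod_closed (jacobian_in_sat f).
Proof.
have [J0 Jlin] := jacobian_idealP f.
split=> [|a g h gJ hJ]; first by rewrite unfold_in raddf0.
by apply: Jlin.
Qed.

HB.instance Definition _ f :=
  GRing.isSubmodClosed.Build S (jacobian_sat_module f) (jacobian_in_sat f)
    (GRing.submod_closed_semi (jacobian_in_satP f)).

(* The S-module N(f); its K-linear structure is obtained through K -> S. *)
Definition jacobian_module f : lmodType S := lmod_quot (jacobian_in_sat f).

Definition jacobian_piece f p : set (jacobian_module f) :=
  [set n | exists2 g : jacobian_sat_module f,
     val g \is p.-homog & n = \pi_(lmod_quot (jacobian_in_sat f)) g].

(* A line of P^2 is given by the coefficients, not all zero and up to a
   scalar, of its equation. *)
Definition line_form (v : 'rV[K]_3) : S := \sum_(i < 3) v 0 i *: 'X_i.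

(* The preimage in K^3 \ {0} of a Zariski open subset of P(S_1). *)
Definition zariski_open (U : set 'rV[K]_3) : Prop :=
  exists F : set S,
    (forall G, F G -> exists e, G \is e.-homog) /\
    U = [set v : 'rV[K]_3 | v != 0 /\ exists2 G, F G & G.@[v 0] != 0].

Definition for_generic_line (P : S -> Prop) : Prop :=
  exists U : set 'rV[K]_3,
    [/\ zariski_open U, U !=set0 & forall v, U v -> P (line_form v)].

End PlaneCurve.

Arguments jacobian_in_sat {K} f _.
Arguments jacobian_piece {K} f p _.

(* Main.v *)
(* Write D(u) = u_1 f_x + u_2 f_y + u_3 f_z for a triple u, and let
   rho be a minimal syzygy, of degree r.  For a line alpha = 0 that meets
   neither the singular points of C nor the common zeros of rho, the triples
   grad f and rho have no common zero on the line, so modulo every power of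
   alpha a triple parallel to grad f (or to rho) is a multiple of it, and a
   triple orthogonal to rho is a cross product with rho as soon as its degree is
   large enough.

   Injectivity.  If alpha g = D(a), then (a x rho) x grad f = alpha g rho, so
   a x rho = h grad f modulo alpha, where deg h < 0 by the bound on q.  Hence
   a x rho = 0 modulo alpha, a = s rho + alpha b, and g = D(b).

   Surjectivity.  If alpha^k g = D(a), then a x rho = h grad f modulo alpha^k.
   The triple h grad f is orthogonal to rho and, by the bound on p, equals
   b x rho modulo alpha^(k+1).  Then D(b) = alpha^(k+1) g', a - b is a multiple
   of rho modulo alpha^k, and therefore g - alpha g' lies in the Jacobian ideal.

   Genericity.  The common zeros of rho, and of grad f, are finite in number: by
   minimality of r (resp. since f is reduced) a Bezout relation in K(x)[z]
   eliminates z, and no linear form divides the triple. *)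
Require Import Defs.
From HB Require Import structures.
From mathcomp Require Import all_boot all_order all_algebra.
From mathcomp Require Import separable.
From mathcomp Require Import complex mpoly ring zify.
From mathcomp Require Import boolp classical_sets functions reals.

Set Implicit Arguments.
Unset Strict Implicit.
Unset Printing Implicit Defensive.

Import Order.TTheory GRing.Theory Num.Theory.
Local Open Scope ring_scope.

(** * Triples of polynomials *)

Section HomogeneousParts.
Variables (n : nat) (R : idomainType).
Implicit Types (p q : {mpoly R[n]}) (d e k : nat).

(* The part of degree [k - e] of [q], read as [0] when [k < e]. *)
Definition hpart k e q : {mpoly R[n]} :=
  if (e <= k)%N then pihomog mdeg (k - e) q else 0.

Lemma hpart_homog k e q : hpart k e q \is (k - e).-homog.
Proof. by rewrite /hpart; case: ifP => _; rewrite ?rpred0 ?pihomogP. Qed.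

(** A relation with homogeneous generators stays true when its coefficients are replaced by
    homogeneous parts of the right degree. A negative degree makes the coefficient vanish, which is
    how the degree bounds act later. *)
Lemma pihomogM k e p q :
  p \is e.-homog -> pihomog mdeg k (p * q) = p * hpart k e q.
Proof.
move=> ph; rewrite {1}(pihomog_partitionE (leqnn (msize q))) mulr_sumr.
rewrite raddf_sum /= /hpart; have [le_ek|lt_ke] := leqP e k; last first.
  rewrite mulr0 big1 // => i _; apply: (@pihomog_ne0 _ _ _ (e + i)); first lia.
  by rewrite dhomogM ?pihomogP.
rewrite -[in RHS](subnKC le_ek); set l := (k - e)%N.
have piE i : pihomog mdeg k (p * pihomog mdeg i q) =
    p * pihomog mdeg l (pihomog mdeg i q).
  have [->|ne_il] := eqVneq i l.
    rewrite pihomog_id pihomog_dE //.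
    have <- : (e + l)%N = k by rewrite /l; lia.
    by rewrite dhomogM ?pihomogP.
  rewrite (pihomog_ne0 ne_il) ?pihomogP // mulr0.
  apply: (@pihomog_ne0 _ _ _ (e + i)); first by rewrite /l in ne_il; lia.
  by rewrite dhomogM ?pihomogP.
have -> : (e + l - e)%N = l by lia.
under eq_bigr do rewrite piE.
by rewrite -mulr_sumr -raddf_sum -pihomog_partitionE.
Qed.

Lemma dhomog_cancel d e p q :
  p != 0 -> p \is e.-homog -> p * q \is d.-homog -> q = hpart d e q.
Proof.
move=> p0 ph pqh; apply: (mulfI p0).
by rewrite -pihomogM // pihomog_dE.
Qed.

Lemma dhomogXn (i : 'I_n) k : ('X_i ^+ k : {mpoly R[n]}) \is k.-homog.
Proof.
rewrite -[X in X.-homog]mul1n dhomogMn // dhomogX; apply/eqP; exact: mdeg1.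
Qed.

Lemma mpolyX_dvd (i : 'I_n) M p :
  (forall m, m \in msupp p -> M <= m i)%N -> exists q, p = 'X_i ^+ M * q.
Proof.
move=> hp; exists (\sum_(m <- msupp p) p@_m *: 'X_[m - U_(i) *+ M]).
rewrite mulr_sumr [LHS]mpolyE; apply: eq_big_seq => m /hp hm.
rewrite -scalerAr mpolyXn -mpolyXD addmC submK //.
by apply/mnm_lepP => j; rewrite mulmnE mnm1E; case: eqP => [<-|]; lia.
Qed.

Lemma msuppXnM (i : 'I_n) M p m :
  m \in msupp ('X_i ^+ M * p) -> (M <= m i)%N.
Proof.
rewrite mulrC mpolyXn (perm_mem (msuppMX _ _)) => /mapP[m' _ ->].
by rewrite mnmDE mulmnE mnm1E eqxx; lia.
Qed.

(** Coprimality of powers of distinct variables, read off the supports: multiplying by a power of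
    one variable leaves the exponents of the other unchanged. *)
Lemma mpolyX_coprime (i j : 'I_n) M N p q : i != j ->
  'X_j ^+ N * p = 'X_i ^+ M * q -> exists s, p = 'X_i ^+ M * s.
Proof.
move=> ij pq; apply: mpolyX_dvd => m mp.
have : (U_(j) *+ N + m)%MM \in msupp ('X_j ^+ N * p).
  rewrite mulrC mpolyXn (perm_mem (msuppMX _ _)).
  by apply/mapP; exists m; rewrite // addmC.
rewrite pq => /msuppXnM; rewrite mnmDE mulmnE mnm1E eq_sym (negPf ij).
by rewrite mul0n.
Qed.

End HomogeneousParts.

(** * Dot and cross products of triples *)

Section Triples.
Variable R : comRingType.
Implicit Types u v w : 'I_3 -> R.

Definition i0 : 'I_3 := @Ordinal 3 0 isT.
Definition i1 : 'I_3 := @Ordinal 3 1 isT.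
Definition i2 : 'I_3 := @Ordinal 3 2 isT.

Lemma ord3P (P : 'I_3 -> Prop) : P i0 -> P i1 -> P i2 -> forall i, P i.
Proof.
move=> P0 P1 P2 [[|[|[|//]]] hi].
- by rewrite (_ : Ordinal hi = i0) //; apply/val_inj.
- by rewrite (_ : Ordinal hi = i1) //; apply/val_inj.
- by rewrite (_ : Ordinal hi = i2) //; apply/val_inj.
Qed.

Lemma sum_ord3 (V : nmodType) (F : 'I_3 -> V) :
  \sum_(i < 3) F i = F i0 + F i1 + F i2.
Proof.
rewrite !big_ord_recr big_ord0 /= add0r.
by congr (F _ + F _ + F _); apply/val_inj.
Qed.

Definition dot u v : R := \sum_(i < 3) u i * v i.

Definition cross u v (i : 'I_3) : R :=
  match val i with
  | 0 => u i1 * v i2 - u i2 * v i1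
  | 1 => u i2 * v i0 - u i0 * v i2
  | _ => u i0 * v i1 - u i1 * v i0
  end.

Lemma dotE u v : dot u v = u i0 * v i0 + u i1 * v i1 + u i2 * v i2.
Proof. exact: sum_ord3. Qed.

Lemma dotC u v : dot u v = dot v u.
Proof. by apply: eq_bigr => i _; rewrite mulrC. Qed.

(** The vector triple product identity. When [dot v w = 0] it turns a membership in the ideal
    generated by [w] into a statement on cross products with [v], which drives both halves of the
    proof. *)
Lemma cross_crossl u v w i :
  cross (cross u v) w i = dot u w * v i - dot v w * u i.
Proof. by elim/ord3P: i; rewrite /cross !dotE /=; ring. Qed.

Lemma dot_crossr u v : dot (cross u v) v = 0.
Proof. by rewrite dotE /cross /=; ring. Qed.

Lemma cross_eq0P u v :
  (forall i, cross u v i = 0) -> forall i j, u i * v j = u j * v i.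
Proof.
move=> uv; move: (uv i0) (uv i1) (uv i2); rewrite /cross /=.
move=> /eqP; rewrite subr_eq0 => /eqP e0 /eqP.
rewrite subr_eq0 => /eqP e1 /eqP; rewrite subr_eq0 => /eqP e2.
by elim/ord3P => j; elim/ord3P: j.
Qed.

Lemma crossDl u v w i : cross (fun j => u j + v j) w i = cross u w i + cross v w i.
Proof. by elim/ord3P: i; rewrite /cross /=; ring. Qed.

Lemma crossZl a u w i : cross (fun j => a * u j) w i = a * cross u w i.
Proof. by elim/ord3P: i; rewrite /cross /=; ring. Qed.

Lemma eq_crossl u v w : u =1 v -> cross u w =1 cross v w.
Proof. by move=> uv i; rewrite /cross !uv. Qed.

Lemma eq_cross u u' v v' : u =1 u' -> v =1 v' -> cross u v =1 cross u' v'.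
Proof. by move=> uu' vv' i; rewrite /cross !uu' !vv'. Qed.

Lemma dotDl u v w : dot (fun j => u j + v j) w = dot u w + dot v w.
Proof. by rewrite !dotE; ring. Qed.

Lemma dotZl a u w : dot (fun j => a * u j) w = a * dot u w.
Proof. by rewrite !dotE; ring. Qed.

Lemma eq_dotl u v w : u =1 v -> dot u w = dot v w.
Proof. by move=> uv; apply: eq_bigr => i _; rewrite uv. Qed.

Lemma eq_dotr u v w : u =1 v -> dot w u = dot w v.
Proof. by move=> uv; apply: eq_bigr => i _; rewrite uv. Qed.

End Triples.

Lemma rmorph_dot (R R' : comRingType) (s : {rmorphism R -> R'}) u v :
  s (dot u v) = dot (fun i => s (u i)) (fun i => s (v i)).
Proof. by rewrite rmorph_sum; apply: eq_bigr => i _; rewrite rmorphM. Qed.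

Lemma rmorph_cross (R R' : comRingType) (s : {rmorphism R -> R'}) u v i :
  s (cross u v i) = cross (fun i => s (u i)) (fun i => s (v i)) i.
Proof. by elim/ord3P: i; rewrite /cross /= rmorphB !rmorphM. Qed.

Lemma dot_homog (K : idomainType) d e (u v : 'I_3 -> {mpoly K[3]}) :
  (forall i, u i \is d.-homog) -> (forall i, v i \is e.-homog) ->
  dot u v \is (d + e).-homog.
Proof. by move=> uh vh; apply: rpred_sum => i _; apply: dhomogM. Qed.

Lemma cross_homog (K : idomainType) d e (u v : 'I_3 -> {mpoly K[3]}) :
  (forall i, u i \is d.-homog) -> (forall i, v i \is e.-homog) ->
  forall i, cross u v i \is (d + e).-homog.
Proof. by move=> uh vh; elim/ord3P; rewrite /cross /= rpredB ?dhomogM. Qed.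

Lemma pihomog_cross (K : idomainType) n e (u v : 'I_3 -> {mpoly K[3]}) i :
  (forall i, v i \is e.-homog) ->
  pihomog mdeg n (cross u v i) = cross (fun j => hpart n e (u j)) v i.
Proof.
move=> vh; have pE j k : pihomog mdeg n (u j * v k) = hpart n e (u j) * v k.
  by rewrite mulrC (pihomogM _ _ (vh k)) mulrC.
by elim/ord3P: i; rewrite /cross /= raddfB /= !pE.
Qed.

Lemma pihomog_dot (K : idomainType) n e (u v : 'I_3 -> {mpoly K[3]}) :
  (forall i, v i \is e.-homog) ->
  pihomog mdeg n (dot u v) = dot (fun j => hpart n e (u j)) v.
Proof.
move=> vh; rewrite raddf_sum; apply: eq_bigr => j _ /=.
by rewrite mulrC (pihomogM _ _ (vh j)) mulrC.
Qed.

(** * Triples modulo a linear form *)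

Section ModuloLinearForm.
Variable K : fieldType.
Local Notation S := {mpoly K[3]}.
Implicit Types (u v w : 'I_3 -> S) (p q : S).

(** A monomial x^i y^j with i + j >= 2M - 1 has i >= M or j >= M. *)
Lemma binary_split M N h :
  (2 * M <= N.+1)%N -> h \is N.-homog ->
  (forall m, m \in msupp h -> m i2 = 0%N) ->
  exists h1 h2 : S, h = 'X_i1 ^+ M * h1 + 'X_i0 ^+ M * h2.
Proof.
move=> leMN /dhomogP hh h2.
pose P (m : 'X_{1..3}) := (M <= m i1)%N.
pose part (Q : pred 'X_{1..3}) : S := \sum_(m <- msupp h | Q m) h@_m *: 'X_[m].
have msupp_part Q m : m \in msupp (part Q) -> m \in msupp h /\ Q m.
  move=> /msupp_sum_le /flatten_mapP[m' ]; rewrite mem_filter => /andP[Qm' m'h].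
  by move=> /msuppZ_le; rewrite msuppX inE => /eqP ->.
have [|q1 q1E] := @mpolyX_dvd _ _ i1 M (part P).
  by move=> m /msupp_part[].
have [|q2 q2E] := @mpolyX_dvd _ _ i0 M (part (predC P)).
  move=> m /msupp_part[mh]; rewrite /= /P -ltnNge => m1.
  by have := hh m mh; rewrite [LHS]mdegE sum_ord3 (h2 m mh); lia.
exists q1, q2; rewrite -q1E -q2E [LHS]mpolyE.
by rewrite (bigID P).
Qed.

(* [sigma] is the restriction to the line [alpha = 0], identified with the
   projective line with coordinates x, y by eliminating z. *)
Record line_restriction (alpha : S) (sigma : {rmorphism S -> S}) : Prop := {
  lr_homog1 : alpha \is 1.-homog;
  lr_neq0 : alpha != 0;
  lr_alpha : sigma alpha = 0;
  lr_mod : forall p, exists c, p = sigma p + alpha * c;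
  lr_X0 : sigma 'X_i0 = 'X_i0;
  lr_X1 : sigma 'X_i1 = 'X_i1;
  lr_homog : forall d p, p \is d.-homog -> sigma p \is d.-homog;
  lr_binary : forall p m, m \in msupp (sigma p) -> m i2 = 0%N
}.

Variables (alpha : S) (sigma : {rmorphism S -> S}).
Hypothesis lr : line_restriction alpha sigma.

Let alpha_homog := lr_homog1 lr.
Let alpha_neq0 := lr_neq0 lr.
Let sigma_alpha := lr_alpha lr.
Let sigma_mod := lr_mod lr.
Let sigmaX0 := lr_X0 lr.
Let sigmaX1 := lr_X1 lr.
Let sigma_homog := lr_homog lr.
Let sigma_binary := lr_binary lr.

Lemma sigmaK p : sigma (sigma p) = sigma p.
Proof.
have [c pE] := sigma_mod p.
by rewrite [in RHS]pE rmorphD rmorphM sigma_alpha mul0r addr0.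
Qed.

Lemma sigma_eq0 p : sigma p = 0 -> exists c, p = alpha * c.
Proof. by move=> p0; have [c ->] := sigma_mod p; exists c; rewrite p0 add0r. Qed.

Lemma sigma_alphaM p : sigma (alpha * p) = 0.
Proof. by rewrite rmorphM sigma_alpha mul0r. Qed.

(* The restriction of [phi] to the line has no common zero. *)
Definition line_coprime (phi : 'I_3 -> S) := exists M,
  (exists c b, 'X_i0 ^+ M = dot c phi + alpha * b) /\
  (exists c b, 'X_i1 ^+ M = dot c phi + alpha * b).

Variables (e : nat) (phi : 'I_3 -> S).
Hypothesis phi_homog : forall i, phi i \is e.-homog.
Hypothesis phi_coprime : line_coprime phi.

Let phi' i := sigma (phi i).

Lemma restr_homog i : phi' i \is e.-homog.
Proof. exact: sigma_homog. Qed.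

Lemma mpolyXn_neq0 (i : 'I_3) M : 'X_i ^+ M != 0 :> S.
Proof. by rewrite expf_neq0 // -msize_poly_eq0 msizeX. Qed.

Lemma restr_coprime : exists M, (e <= M)%N /\ exists c1 c2 : 'I_3 -> S,
  [/\ forall i, c1 i \is (M - e).-homog, forall i, c2 i \is (M - e).-homog,
      'X_i0 ^+ M = dot c1 phi' & 'X_i1 ^+ M = dot c2 phi'].
Proof.
have [M [[c1 [b1 E1]] [c2 [b2 E2]]]] := phi_coprime.
have red (i : 'I_3) c b : sigma 'X_i = 'X_i -> 'X_i ^+ M = dot c phi + alpha * b ->
    'X_i ^+ M = dot (fun j => hpart M e (sigma (c j))) phi'.
  move=> sX XE; have : pihomog mdeg M ('X_i ^+ M : S) = 'X_i ^+ M.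
    by apply: pihomog_dE; apply: dhomogXn.
  move=> <-; rewrite -[in LHS]sX -rmorphXn /= XE rmorphD /= sigma_alphaM addr0.
  by rewrite rmorph_dot (pihomog_dot _ _ restr_homog).
move: (red i0 _ _ sigmaX0 E1) (red i1 _ _ sigmaX1 E2) => {}E1 {}E2.
(* If M < e, every coefficient [hpart M e _] is 0 by convention, and x^M would vanish. *)
have leM : (e <= M)%N.
  rewrite leqNgt; apply/negP => ltM; move/eqP: E1.
  rewrite /dot big1 => [|i _]; last by rewrite /hpart leqNgt ltM mul0r.
  by rewrite (negPf (mpolyXn_neq0 _ _)).
by exists M; split=> //; do 2?eexists; split; [| |exact: E1|exact: E2] => i;
  apply: hpart_homog.
Qed.

Lemma restr_neq0 : exists i, phi' i != 0.
Proof.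
have [M [_ [c1 [_ [_ _ X0E _]]]]] := restr_coprime.
apply: contrapT => phi0; have := mpolyXn_neq0 i0 M; rewrite X0E.
case/eqP; rewrite /dot big1 // => i _.
have [->|phi_i] := eqVneq (phi' i) 0; first by rewrite mulr0.
by case: phi0; exists i.
Qed.

(** Writing x^M and y^M as combinations c1, c2 of [phi'] gives x^M v = (c1.v) phi' and y^M v =
    (c2.v) phi'. Hence y^M (c1.v) = x^M (c2.v), so x^M divides c1.v, and the quotient is the factor
    sought. *)
Lemma parallel_on_line v : (forall i, cross v phi' i = 0) ->
  exists h, forall i, v i = h * phi' i.
Proof.
move=> /cross_eq0P vphi.
have [M [_ [c1 [c2 [_ _ X0E X1E]]]]] := restr_coprime.
have cE c i : dot c phi' * v i = dot c v * phi' i.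
  rewrite !dotE; rewrite !mulrDl -!mulrA.
  by rewrite -!(mulrC (v i)) !(vphi i).
have [k phik] := restr_neq0.
have [] := @mpolyX_coprime _ _ i0 i1 M M (dot c1 v) (dot c2 v).
- by [].
- apply: (mulIf phik); rewrite -!mulrA -!cE -X0E -X1E.
  by rewrite !mulrA ['X_i1 ^+ M * _]mulrC.
move=> s sE; exists s => i; apply: (mulfI (mpolyXn_neq0 i0 M)).
by rewrite mulrA -sE [in LHS]X0E cE.
Qed.

Lemma parallel_mod v : (forall i, sigma (cross v phi i) = 0) ->
  exists h w, forall i, v i = h * phi i + alpha * w i.
Proof.
move=> vphi; have [|h hE] := @parallel_on_line (fun i => sigma (v i)).
  by move=> i; rewrite -[RHS](vphi i) rmorph_cross.
have /choice[w wE] : forall i, exists c, v i - h * phi i = alpha * c.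
  move=> i.
  have [c vE] := sigma_mod (v i); have [c' phiE] := sigma_mod (phi i).
  by exists (c - h * c'); rewrite [in LHS]vE [in LHS]phiE hE; ring.
by exists h, w => i; rewrite -wE; ring.
Qed.

Lemma parallel_mod_exp k v :
  (forall i, exists c, cross v phi i = alpha ^+ k * c) ->
  exists h w, forall i, v i = h * phi i + alpha ^+ k * w i.
Proof.
elim: k v => [|k IH] v vphi.
  by exists 0, v => i; rewrite mul0r add0r expr0 mul1r.
have [|h [w vE]] := @parallel_mod v.
  by move=> i; have [c ->] := vphi i; rewrite exprS -mulrA sigma_alphaM.
have [|h' [w' wE]] := IH w.
  move=> i; have [c cE] := vphi i; exists c; apply: (mulfI alpha_neq0).
  rewrite -crossZl mulrA -exprS -cE.
  have -> : cross v phi i =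
      cross (fun j => h * phi j) phi i + cross (fun j => alpha * w j) phi i.
    by rewrite -crossDl; apply: eq_crossl => j.
  by rewrite [cross (fun j => h * _) _ _]crossZl; elim/ord3P: i {cE};
    rewrite /cross /=; ring.
by exists (h + alpha * h'), w' => i; rewrite vE wE exprS; ring.
Qed.

(** Exactness of the Koszul complex of [phi'] on the line, in large degree. As v' is orthogonal to
    [phi'], the crosses c1 x v' and c2 x v' map to x^M v' and y^M v'. The combination [D] is then h'
    phi', and splitting h' over y^M and x^M corrects c1 x v' to a multiple of x^M; the quotient [s]
    satisfies s x phi' = v'. *)
Lemma koszul_mod n v :
  (2 * e <= n.+1)%N -> (forall i, v i \is n.-homog) ->
  sigma (dot v phi) = 0 ->
  exists b w, forall i, v i = cross b phi i + alpha * w i.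
Proof.
move=> le_en vh vphi.
have [M [leM [c1 [c2 [c1h c2h X0E X1E]]]]] := restr_coprime.
pose v' i := sigma (v i).
have v'phi : dot v' phi' = 0 by rewrite -rmorph_dot.
have homE c : (forall i, c i \is (M - e).-homog) -> forall i,
    'X_i0 ^+ M * cross c v' i \is (2 * M + n - e).-homog /\
    'X_i1 ^+ M * cross c v' i \is (2 * M + n - e).-homog.
  move=> ch i; have -> : (2 * M + n - e = M + ((M - e) + n))%N by lia.
  by split; apply: dhomogM (dhomogXn _ _ _) _; apply: cross_homog => // j;
    apply: sigma_homog.
have v'E c i : cross (cross c v') phi' i = dot c phi' * v' i.
  by rewrite cross_crossl v'phi mul0r subr0.
pose D i := 'X_i1 ^+ M * cross c1 v' i - 'X_i0 ^+ M * cross c2 v' i.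
have [|h hE] := @parallel_on_line D.
  move=> i; have -> : cross D phi' i =
      'X_i1 ^+ M * cross (cross c1 v') phi' i -
      'X_i0 ^+ M * cross (cross c2 v') phi' i.
    by rewrite /D; elim/ord3P: i; rewrite /cross /=; ring.
  by rewrite !v'E -X0E -X1E; ring.
pose h' := hpart (2 * M + n - e) e h.
have h'E i : D i = h' * phi' i.
  rewrite mulrC -pihomogM ?restr_homog // mulrC -hE pihomog_dE //.
  by rewrite rpredB //; [case: (homE c1 c1h i)|case: (homE c2 c2h i)].
(* [h'] has degree at least [2 * M - 1], so lies in the ideal (x^M, y^M). *)
have [||h1 [h2 h12]] := @binary_split M _ (sigma h') _ (sigma_homog (hpart_homog _ _ _)).
- lia.
- exact: sigma_binary.
(* Everything is passed through [sigma] again, because the splitting of h' requires a polynomial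
   free of z. *)
pose cs c i := cross (fun j => sigma (c j)) v' i.
have phi'K i : sigma (phi' i) = phi' i by rewrite /phi' sigmaK.
have v'K i : sigma (v' i) = v' i by rewrite /v' sigmaK.
have csE c i : sigma (cross c v' i) = cs c i.
  by rewrite rmorph_cross; elim/ord3P: i;
     rewrite /cs /cross /= !v'K.
have key i : 'X_i1 ^+ M * (cs c1 i - h1 * phi' i) =
             'X_i0 ^+ M * (cs c2 i + h2 * phi' i).
  have := congr1 sigma (h'E i); rewrite /D rmorphB !rmorphM !rmorphXn /=.
  rewrite sigmaX0 sigmaX1 !csE phi'K h12 => E.
  apply/eqP; rewrite -subr_eq0; apply/eqP.
  by rewrite mulrBr mulrDr opprD addrACA -opprD E; ring.
have /choice[s sE] : forall i, exists c, cs c1 i - h1 * phi' i = 'X_i0 ^+ M * c.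
  move=> i.
  by apply: mpolyX_coprime (key i).
have v'E2 i : v' i = cross s phi' i.
  apply: (mulfI (mpolyXn_neq0 i0 M)); rewrite -crossZl.
  have -> : cross (fun j => 'X_i0 ^+ M * s j) phi' i = cross (cs c1) phi' i.
    rewrite (@eq_crossl _ _ (fun j => cs c1 j - h1 * phi' j)) => [|j]; last first.
      by rewrite sE.
    by elim/ord3P: i; rewrite /cross /=; ring.
  have := congr1 sigma (v'E c1 i); rewrite -X0E rmorphM rmorphXn /= sigmaX0 v'K => <-.
  by rewrite rmorph_cross; apply: eq_cross => j /=; rewrite ?phi'K ?csE.
have /choice[w wE] : forall i, exists c, v i - cross s phi i = alpha * c.
  move=> i.
  apply: sigma_eq0; rewrite rmorphB /= rmorph_cross -/(v' i) -[v' i]v'K v'E2.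
  by rewrite rmorph_cross; elim/ord3P: i; rewrite /cross /= !phi'K subrr.
by exists s, w => i; rewrite -wE; ring.
Qed.

(** Once v = b x phi + alpha w, the dot product with [phi] shows that w satisfies the hypothesis for
    the next lower power. Each power of [alpha] lowers the degree of the remainder by one, whence
    the term k in the bound. *)
Lemma koszul_mod_exp k n v : (0 < e)%N ->
  (2 * e + k <= n.+2)%N -> (forall i, v i \is n.-homog) ->
  (exists c, dot v phi = alpha ^+ k * c) ->
  exists b w, forall i, v i = cross b phi i + alpha ^+ k * w i.
Proof.
move=> e0; elim: k n v => [|k IH] n v le_n vh [c vphi].
  by exists (fun=> 0), v => i; elim/ord3P: i; rewrite /cross /=; ring.
have [||b [w vE]] := @koszul_mod n v _ vh.
- lia.
- by rewrite vphi exprS -mulrA sigma_alphaM.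
have vE' i : v i = cross (fun j => hpart n e (b j)) phi i + alpha * hpart n 1 (w i).
  rewrite -[LHS](pihomog_dE (vh i)) vE raddfD /= (pihomog_cross _ _ _ phi_homog).
  by rewrite (pihomogM _ _ alpha_homog).
have [|||b' [w' wE]] := IH n.-1 (fun i => hpart n 1 (w i)).
- lia.
- by move=> i; rewrite -subn1 hpart_homog.
- exists c; apply: (mulfI alpha_neq0); rewrite mulrA -exprS -vphi -dotZl.
  rewrite (eq_dotl _ vE') dotDl dot_crossr add0r.
  by apply: eq_dotl => i.
exists (fun i => hpart n e (b i) + alpha * b' i), w' => i.
by rewrite vE' wE exprS; elim/ord3P: i; rewrite /cross /=; ring.
Qed.

(** Monomials of degree 2M restrict into (x^M, y^M), so [phi] and [alpha] together generate a power
    of (x, y, z). This lets powers of [alpha] alone detect the saturation. *)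
Lemma monomials_in_ideal : exists N, forall m : 'X_{1..3}, mdeg m = N ->
  exists c b, 'X_[m] = dot c phi + alpha * b.
Proof.
have [M [[c1 [b1 E1]] [c2 [b2 E2]]]] := phi_coprime.
exists (2 * M)%N => m mE; have [b XE] := sigma_mod 'X_[m].
have [|||h1 [h2 hE]] := @binary_split M (2 * M) (sigma 'X_[m]).
- lia.
- by apply: sigma_homog; rewrite dhomogX; apply/eqP.
- exact: sigma_binary.
exists (fun i => h1 * c2 i + h2 * c1 i), (h1 * b2 + h2 * b1 + b).
by rewrite XE hE E1 E2 dotDl !dotZl; ring.
Qed.

(** [alpha] is prime, being the kernel of a morphism to a domain, and some component of [phi] does
    not vanish on the line. *)
Lemma alpha_cancel k p :
  (forall i, exists c, p * phi i = alpha ^+ k * c) -> exists c, p = alpha ^+ k * c.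
Proof.
have [i phi_i] := restr_neq0; move=> /(_ i); elim: k p => [|k IH] p [c pE].
  by exists p; rewrite expr0 mul1r.
have [|q qE] := @sigma_eq0 p.
  apply/eqP; rewrite -(mulIr_eq0 _ (mulIf phi_i)) -rmorphM pE exprS -mulrA.
  by rewrite sigma_alphaM.
have [|c' qE'] := IH q.
  by exists c; apply: (mulfI alpha_neq0); rewrite !mulrA -exprS -pE qE.
by exists c'; rewrite qE qE' exprS mulrA.
Qed.

End ModuloLinearForm.

(** * Injectivity and surjectivity of multiplication by a linear form *)

Section LefschetzSteps.
Variable K : fieldType.
Local Notation S := {mpoly K[3]}.
Variables (alpha : S) (sigma : {rmorphism S -> S}).
Hypothesis lr : line_restriction alpha sigma.
Variables (r e : nat) (rho grad : 'I_3 -> S).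
Hypothesis rho_homog : forall i, rho i \is r.-homog.
Hypothesis grad_homog : forall i, grad i \is e.-homog.
Hypothesis rho_grad : dot rho grad = 0.
Hypothesis rho_coprime : line_coprime alpha rho.
Hypothesis grad_coprime : line_coprime alpha grad.
Hypothesis lt_re : (r < e)%N.

Lemma lefschetz_inj q (g : S) : (q + r < 2 * e)%N ->
  alpha * g \is q.-homog -> (exists a, alpha * g = dot a grad) ->
  exists a, g = dot a grad.
Proof.
move=> lt_q gh [a0 gE]; pose a i := hpart q e (a0 i).
have {}gE : alpha * g = dot a grad.
  by rewrite -(pihomog_dot _ _ grad_homog) -gE pihomog_dE.
have ah i : a i \is (q - e).-homog by apply: hpart_homog.
have [|h [w aE]] := parallel_mod lr grad_homog grad_coprime (v := cross a rho).
  by move=> i; rewrite cross_crossl rho_grad mul0r subr0 -gE -mulrA sigma_alphaM.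
have {}aE i : cross a rho i = alpha * hpart (q - e + r) 1 (w i).
  rewrite -[LHS](pihomog_dE (cross_homog ah rho_homog i)) aE raddfD /=.
  rewrite mulrC (pihomogM _ _ (grad_homog i)) (pihomogM _ _ (lr_homog1 lr)).
  (* The coefficient of [grad] would have degree q + r - 2e < 0, so its [hpart] is 0. If q < e, the
     truncated q - e is 0 and the comparison reduces to r < e. *)
  by rewrite /hpart ifN ?mulr0 ?add0r // -ltnNge; lia.
have [|s [b abE]] := parallel_mod lr rho_homog rho_coprime (v := a).
  by move=> i; rewrite aE sigma_alphaM.
exists b; apply: (mulfI (lr_neq0 lr)); rewrite gE (eq_dotl _ abE) dotDl !dotZl.
by rewrite rho_grad mulr0 add0r.
Qed.

Lemma lefschetz_surj q k (g : S) : (0 < r)%N -> (e + r <= q.+1)%N ->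
  g \is q.-homog -> (exists a, alpha ^+ k * g = dot a grad) ->
  exists g' : S, [/\ g' \is q.-1.-homog,
    exists a, alpha ^+ k.+1 * g' = dot a grad &
    exists a, g = alpha * g' + dot a grad].
Proof.
move=> r0 le_q gh [a0 gE]; pose a i := hpart (k + q) e (a0 i).
have alphaXh l : alpha ^+ l \is l.-homog.
  by rewrite -[X in X.-homog]mul1n dhomogMn ?(lr_homog1 lr).
have {}gE : alpha ^+ k * g = dot a grad.
  by rewrite -(pihomog_dot _ _ grad_homog) -gE pihomog_dE // dhomogM.
pose n := (k + q - e + r)%N.
have avh i : cross a rho i \is n.-homog.
  by apply: cross_homog => // j; apply: hpart_homog.
have [|h0 [w0 aE]] := parallel_mod_exp lr grad_homog grad_coprime (k := k)
    (v := cross a rho).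
  move=> i; exists (g * rho i).
  by rewrite cross_crossl rho_grad mul0r subr0 -gE mulrA.
pose h := hpart n e h0; pose w i := hpart n k (w0 i); pose u i := h * grad i.
have {}aE i : cross a rho i = u i + alpha ^+ k * w i.
  rewrite -[LHS](pihomog_dE (avh i)) aE raddfD /= (pihomogM _ _ (alphaXh k)).
  by rewrite mulrC (pihomogM _ _ (grad_homog i)) mulrC.
have uh i : u i \is n.-homog.
  by rewrite /u mulrC -(pihomogM _ _ (grad_homog i)) pihomogP.
have [||b [w' bE]] := koszul_mod_exp lr rho_homog rho_coprime (k := k.+1) r0 _ uh.
(* The requirement 2r + (k + 1) <= n + 2, with n = k + q - e + r, amounts to the hypothesis
   [e + r <= q.+1]. *)
- by rewrite /n; lia.
- by exists 0; rewrite dotZl dotC rho_grad !mulr0.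
(* By the triple product, (b.grad) rho = (b x rho) x grad, and b x rho agrees modulo alpha^(k+1)
   with [u], which is parallel to [grad]; then [rho] is cancelled. *)
have [|g' g'E] := alpha_cancel lr rho_homog rho_coprime (k := k.+1) (p := dot b grad).
  move=> i; exists (- cross w' grad i).
  have := cross_crossl b rho grad i; rewrite rho_grad mul0r subr0 => <-.
  have : cross u grad i = 0 by rewrite /u crossZl; elim/ord3P: i; rewrite /cross /=; ring.
  rewrite (@eq_cross _ _ _ _ grad bE) // crossDl crossZl => /eqP.
  by rewrite addr_eq0 => /eqP ->; ring.
have [|s [c abE]] := parallel_mod_exp lr rho_homog rho_coprime (k := k)
    (v := fun i => a i - b i).
  move=> i; exists (w i + alpha * w' i).
  transitivity (cross a rho i - cross b rho i).
    by elim/ord3P: i; rewrite /cross /=; ring.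
  by rewrite aE bE exprS; ring.
have gg' : g = alpha * g' + dot c grad.
  apply: (mulfI (expf_neq0 k (lr_neq0 lr))); rewrite mulrDr mulrA -exprSr -g'E gE.
  have -> : dot a grad = dot b grad + dot (fun i => a i - b i) grad.
    by rewrite -dotDl; apply: eq_dotl => i; ring.
  by rewrite (eq_dotl _ abE) dotDl !dotZl rho_grad mulr0 add0r.
(* [g'] comes without a degree, so its part of degree q - 1 is used and both relations are cut down
   to their homogeneous parts. *)
exists (hpart q 1 g'); split; first by rewrite -subn1 hpart_homog.
  exists (fun i => hpart (k + q) e (b i)).
  rewrite -(pihomog_dot _ _ grad_homog) g'E (pihomogM _ _ (alphaXh _)) /hpart.
  rewrite (_ : k < k + q)%N; last lia.
  by rewrite (_ : 0 < q)%N; [congr (_ * pihomog _ _ _) |]; lia.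
exists (fun i => hpart q e (c i)).
rewrite -(pihomog_dot _ _ grad_homog) -(pihomogM _ _ (lr_homog1 lr)) -raddfD /=.
by rewrite -gg' pihomog_dE.
Qed.

End LefschetzSteps.

(** * Dehomogenization *)

Section MpolyMorphisms.
Variables (n : nat) (R : comRingType).
Local Notation S := {mpoly R[n]}.

Lemma mpoly_ind_ring (P : S -> Prop) :
  (forall c, P c%:MP) -> (forall i, P 'X_i) ->
  (forall p q, P p -> P q -> P (p + q)) ->
  (forall p q, P p -> P q -> P (p * q)) -> forall p, P p.
Proof.
move=> PC PX PD PM p; rewrite [p]mpolyE; elim/big_ind: _ => [||m _] //.
  by rewrite -mpolyC0.
rewrite -mul_mpolyC; apply: (PM) => //; rewrite mpolyXE_id.
elim/big_ind: _ => [||i _] //; first by rewrite -mpolyC1.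
by elim: (m i) => [|k IH]; rewrite ?expr0 -?mpolyC1 // exprS; apply: PM.
Qed.

(** Used below to compare the various substitutions and evaluations on generators only. *)
Lemma mpoly_rmorph_eq (A : comRingType) (s t : {rmorphism S -> A}) :
  (forall c, s c%:MP = t c%:MP) -> (forall i, s 'X_i = t 'X_i) -> s =1 t.
Proof.
move=> sC sX; apply: mpoly_ind_ring => // p q sp sq; first by rewrite !rmorphD sp sq.
by rewrite !rmorphM sp sq.
Qed.

Lemma mmapXU (A : comRingType) (f : {rmorphism R -> A}) (h : 'I_n -> A) i :
  mmap f h 'X_i = h i.
Proof. by rewrite mmapX mmap1U. Qed.

End MpolyMorphisms.

Section Dehomogenization.
Variable K : fieldType.
Local Notation S := {mpoly K[3]}.
Local Notation T := {poly {poly K}}.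
Implicit Types (f p q : S) (g u : T).

(* The chart y = 1, as a polynomial in z over K[x]. *)
Definition chart : S -> T :=
  mmap (polyC \o polyC) (fun i : 'I_3 =>
    match val i with 0 => 'X%:P | 1 => 1 | _ => 'X end).
HB.instance Definition _ := GRing.RMorphism.on chart.

Lemma chartC c : chart c%:MP = c%:P%:P.
Proof. exact: mmapC. Qed.

Lemma chartZ c p : chart (c *: p) = c%:P%:P * chart p.
Proof. exact: mmapZ. Qed.

Lemma chart_dot (u v : 'I_3 -> S) :
  chart (dot u v) = dot (fun i => chart (u i)) (fun i => chart (v i)).
Proof. exact: rmorph_dot. Qed.

Lemma chartX m : chart 'X_[m] = ('X^(m i0))%:P * 'X^(m i2).
Proof.
rewrite /chart mmapX /mmap1 !big_ord_recl big_ord0 /= expr1n mulr1 mul1r.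
rewrite polyC_exp; congr (_ ^+ m _ * _ ^+ m _); exact/val_inj.
Qed.

Lemma chart_coef p i j :
  (chart p)`_j`_i = \sum_(m <- msupp p) p@_m * ((m i0 == i) && (m i2 == j))%:R.
Proof.
rewrite [in LHS](mpolyE p) raddf_sum coef_sum coef_sum.
apply: eq_bigr => m _; rewrite -mul_mpolyC /= rmorphM /= chartC chartX.
rewrite !coefCM coefXn andbC.
have [_|_] := eqVneq j (m i2); last by rewrite mulr0 coef0 mulr0.
by rewrite mulr1 coefXn eq_sym.
Qed.

(** In a fixed degree the exponents of x and z determine the monomial, so no cancellation occurs
    when y is set to 1. *)
Lemma chart_inj d p : p \is d.-homog -> chart p = 0 -> p = 0.
Proof.
move=> /dhomogP ph p0; apply/mpolyP => m; rewrite mcoeff0.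
apply/eqP; rewrite mcoeff_eq0; apply/negP => mp.
have := congr1 (fun P : T => P`_(m i2)`_(m i0)) p0.
rewrite chart_coef !coef0 (bigD1_seq m) ?msupp_uniq //= !eqxx mulr1.
rewrite big_seq_cond big1 => [|m' /andP[m'p ne_m'm]].
  by rewrite addr0 => /eqP; rewrite mcoeff_eq0 mp.
case: andP => [[/eqP m0 /eqP m2]|]; last by rewrite mulr0.
case/eqP: ne_m'm; apply/mnmP; apply: ord3P => //.
have /= := ph m mp; have /= := ph m' m'p.
by rewrite !mdegE !sum_ord3 m0 m2 => <- /addIn /addnI.
Qed.

Lemma chart_homog_inj d p q :
  p \is d.-homog -> q \is d.-homog -> chart p = chart q -> p = q.
Proof.
move=> ph qh pq; apply/eqP; rewrite -subr_eq0; apply/eqP.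
by apply: (chart_inj (rpredB ph qh)); rewrite raddfB /= pq subrr.
Qed.

(** The section of [chart] whose values do not involve y. *)
Definition unchart : T -> S :=
  horner_eval 'X_i2 \o map_poly (horner_eval 'X_i0 \o map_poly (@mpolyC 3 K)).
HB.instance Definition _ := GRing.RMorphism.on unchart.

Lemma unchartX : unchart 'X = 'X_i2.
Proof. by rewrite /unchart /= map_polyX /horner_eval hornerX. Qed.

Lemma unchartXC : unchart 'X%:P = 'X_i0.
Proof.
by rewrite /unchart /= map_polyC /= /horner_eval hornerC map_polyX hornerX.
Qed.

Lemma unchartB g u : unchart (g - u) = unchart g - unchart u.
Proof. exact: rmorphB. Qed.

Lemma unchartC c : unchart c%:P%:P = c%:MP.
Proof.
by rewrite /unchart /= map_polyC /= /horner_eval hornerC map_polyC hornerC.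
Qed.

Lemma unchartK : cancel unchart chart.
Proof.
have chX i : chart 'X_i = match val i with 0 => 'X%:P | 1 => 1 | _ => 'X end.
  exact: mmapXU.
have inner (c : {poly K}) : chart (unchart c%:P) = c%:P.
  elim/poly_ind: c => [|c k IH]; first by rewrite !rmorph0.
  by rewrite polyCD polyCM !rmorphD /= !rmorphM /= IH unchartXC unchartC chartC chX /=.
elim/poly_ind => [|g c IH]; first by rewrite !rmorph0.
by rewrite !rmorphD /= !rmorphM /= IH unchartX inner chX /=.
Qed.

(** Homogenization with respect to y. The truncated exponent of y is the intended one only when n
    bounds the degree of [p]. *)
Definition homogenize n p : S :=
  \sum_(m <- msupp p) p@_m *: ('X_[m] * 'X_i1 ^+ (n - mdeg m)).

Lemma chart_homogenize n p : chart (homogenize n p) = chart p.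
Proof.
rewrite [in RHS](mpolyE p) /homogenize !raddf_sum; apply: eq_bigr => m _ /=.
rewrite -!mul_mpolyC !rmorphM rmorphXn /= (_ : chart 'X_i1 = 1) ?expr1n ?mulr1 //.
exact: mmapXU.
Qed.

Lemma homogenize_homog n p : (msize p <= n.+1)%N -> homogenize n p \is n.-homog.
Proof.
move=> pn; rewrite /homogenize big_seq; apply: rpred_sum => m mp.
apply: rpredZ; have := msize_mdeg_lt mp => mn.
have : ('X_[m] * 'X_i1 ^+ (n - mdeg m) : S) \is (mdeg m + (n - mdeg m)).-homog.
  by apply: dhomogM (dhomogXn _ _ _); rewrite dhomogX; apply/eqP.
by rewrite subnKC //; lia.
Qed.

(** The total degree in x and z, with the value 0 at the zero polynomial. *)
Definition tdeg g := (msize (unchart g)).-1.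

Lemma unchart_eq0 g : (unchart g == 0) = (g == 0).
Proof. by rewrite -[0 in LHS](rmorph0 unchart) (inj_eq (can_inj unchartK)). Qed.

Lemma tdegM g u : g != 0 -> u != 0 -> tdeg (g * u) = (tdeg g + tdeg u)%N.
Proof.
rewrite -!unchart_eq0 => g0 u0; rewrite /tdeg rmorphM /= msizeM //.
move: g0 u0; rewrite -!msize_poly_eq0.
by case: (mmeasure _ _) => // a; case: (mmeasure _ _) => // b _ _; rewrite addnS.
Qed.

Lemma tdeg_chart d p : p \is d.-homog -> (tdeg (chart p) <= d)%N.
Proof.
move=> /dhomogP ph; rewrite /tdeg.
suff : (msize (unchart (chart p)) <= d.+1)%N by lia.
have -> : unchart (chart p) =
    \sum_(m <- msupp p) p@_m *: ('X_i0 ^+ m i0 * 'X_i2 ^+ m i2).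
  rewrite [in LHS](mpolyE p) (raddf_sum chart) (raddf_sum unchart).
  apply: eq_bigr => m _; rewrite /= -mul_mpolyC !rmorphM /= chartC unchartC chartX.
  by rewrite rmorphM /= polyC_exp !rmorphXn /= unchartXC unchartX mul_mpolyC.
rewrite big_seq; apply: (leq_trans (msize_sum _ _ _)).
apply/bigmax_leqP_seq => m _ mp; apply: (leq_trans (msizeZ_le _ _)).
rewrite !mpolyXn -mpolyXD msizeX mdegD !mdegMn !mdeg1 !mul1n ltnS.
by have /= <- := ph m mp; rewrite mdegE sum_ord3; lia.
Qed.

Lemma homogenize_tdeg g n : (tdeg g <= n)%N ->
  homogenize n (unchart g) \is n.-homog.
Proof. by move=> gn; apply: homogenize_homog; rewrite /tdeg in gn; lia. Qed.

(** Lifts a common factor in the chart to a homogeneous common factor. Total degrees add, so factor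
    and cofactors can be homogenized in complementary degrees, and injectivity of [chart] in degree
    d gives the factorization. The index type serves triples as well as single polynomials. *)
Lemma chart_factor (I : Type) d (p : I -> S) g (u : I -> T) :
  (forall i, p i \is d.-homog) -> (exists i, p i != 0) ->
  (forall i, chart (p i) = g * u i) ->
  exists (G : S) (U : I -> S), [/\ (tdeg g <= d)%N, chart G = g, G \is (tdeg g).-homog,
    forall i, U i \is (d - tdeg g).-homog & forall i, p i = G * U i].
Proof.
move=> ph [i0 pi0] pE.
have chart0 i : (chart (p i) == 0) = (p i == 0).
  by apply/eqP/eqP => [/(chart_inj (ph i))|->]; rewrite ?rmorph0.
have g0 : g != 0.
  by apply: contraNneq pi0 => g0; rewrite -chart0 pE g0 mul0r.
have uE i : u i != 0 -> (tdeg g + tdeg (u i) <= d)%N.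
  by move=> ui; rewrite -tdegM // -pE tdeg_chart.
have gd : (tdeg g <= d)%N.
  have /uE : u i0 != 0 by move: pi0; rewrite -chart0 pE; apply: contraNneq => ->; rewrite mulr0.
  lia.
exists (homogenize (tdeg g) (unchart g)),
  (fun i => homogenize (d - tdeg g) (unchart (u i))).
have Gh : homogenize (tdeg g) (unchart g) \is (tdeg g).-homog.
  exact: homogenize_tdeg.
have Uh i : homogenize (d - tdeg g) (unchart (u i)) \is (d - tdeg g).-homog.
  have [->|/uE ui] := eqVneq (u i) 0.
    by rewrite rmorph0 /homogenize msupp0 big_nil rpred0.
  by apply: homogenize_tdeg; lia.
split=> // [|i]; first by rewrite chart_homogenize unchartK.
have GU := dhomogM Gh (Uh i); rewrite subnKC // in GU.
apply: (chart_homog_inj (ph i) GU).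
by rewrite rmorphM /= !chart_homogenize !unchartK pE.
Qed.

End Dehomogenization.
Arguments chart {K}.
Arguments unchart {K}.

(** * Gauss's lemma in K[x][z] *)

Section Gauss.
Variable K : closedFieldType.
Local Notation T := {poly {poly K}}.
Implicit Types (g u : T) (c : {poly K}).

Definition fiber (a : K) : T -> {poly K} := map_poly (horner_eval a).
HB.instance Definition _ a := GRing.RMorphism.on (fiber a).

Lemma fiberC a c : fiber a c%:P = c.[a]%:P.
Proof. exact: map_polyC. Qed.

Lemma fiber_eq0 a g : fiber a g = 0 -> exists u, g = ('X - a%:P)%:P * u.
Proof.
move=> g0; exists (map_poly (fun c => c %/ ('X - a%:P)) g).
apply/polyP => i; rewrite coefCM coef_map_id0 ?div0p // mulrC divpK //.
rewrite dvdp_XsubCl; apply/rootP.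
by have := congr1 (fun p : {poly K} => p`_i) g0; rewrite coef_map coef0.
Qed.

(** The field being algebraically closed, this says that the content in K[x] is a unit; in this
    form, stability under products is immediate. *)
Definition primitive g := forall a, fiber a g != 0.

(** Gauss's lemma, removing the roots of c one by one: at a root a the left side vanishes while g
    does not, so x - a divides u and can be cancelled. *)
Lemma primitive_dvd g u v c : primitive g -> c != 0 -> c%:P * v = g * u ->
  exists w, v = g * w.
Proof.
move=> gP; have [n] := ubnP (size c); elim: n => // n IH in c u *.
move=> cn c0 vE; have [/size_poly1P[k k0 cE]|] := boolP (size c == 1).
  exists (k^-1%:P%:P * u); rewrite mulrCA -vE cE mulrA -!polyCM mulVf //.
  by rewrite mul1r.
move=> /closed_rootP[a /factor_theorem[c' cE]]; rewrite {}cE in c0 cn vE.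
have [u1 uE] : exists u1, u = ('X - a%:P)%:P * u1.
  apply: fiber_eq0; apply/eqP; have := congr1 (fiber a) vE.
  rewrite !(rmorphM (fiber a)) /= fiberC hornerM hornerXsubC subrr mulr0.
  rewrite polyC0 mul0r => /esym/eqP.
  by rewrite mulf_eq0 (negPf (gP a)).
have Xa0 : 'X - a%:P != 0 by rewrite polyXsubC_eq0.
move: c0; rewrite mulf_eq0 (negPf Xa0) orbF => c'0.
apply: (IH c' u1) => //.
  by move: cn; rewrite size_Mmonic ?monicXsubC // size_XsubC addn2.
apply: (@mulfI _ ('X - a%:P)%:P); first by rewrite polyC_eq0.
by rewrite [RHS]mulrCA -uE -vE polyCM; ring.
Qed.

(** Each factor x - a taken out lowers the degree of the leading coefficient, so the process
    stops. *)
Lemma primitive_part g : g != 0 ->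
  exists c g0, [/\ c != 0, primitive g0 & g = c%:P * g0].
Proof.
have [n] := ubnP (size (lead_coef g)); elim: n => // n IH in g *.
move=> gn g0; have [gP|] := pselect (primitive g).
  by exists 1, g; split; rewrite ?oner_eq0 ?mul1r.
move=> /existsNP[a /negP]; rewrite negbK => /eqP /fiber_eq0[u gE].
have u0 : u != 0 by apply: contraNneq g0 => u0; rewrite gE u0 mulr0.
have [|c [g1 [c0 g1P uE]]] := IH u _ u0.
  have lu0 : lead_coef u != 0 by rewrite lead_coef_eq0.
  by move: gn; rewrite gE lead_coefM lead_coefC mulrC size_Mmonic ?monicXsubC //
    size_XsubC addn2.
exists (('X - a%:P) * c), g1; split=> //.
  by rewrite mulf_neq0 // polyXsubC_eq0.
by rewrite gE uE polyCM mulrA.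
Qed.

End Gauss.

(** * Restriction to a line *)

Definition triple (A : Type) (a b c : A) (i : 'I_3) : A :=
  match val i with 0 => a | 1 => b | _ => c end.

Lemma mmap_scale (n : nat) (R A : comRingType) (f : {rmorphism R -> A})
    (h : 'I_n -> A) a d (p : {mpoly R[n]}) :
  p \is d.-homog -> mmap f (fun i => a * h i) p = a ^+ d * mmap f h p.
Proof.
move=> /dhomogP ph; rewrite mulr_sumr; apply: eq_big_seq => m mp.
rewrite mulrCA; congr (_ * _); rewrite /mmap1.
have /= <- := ph m mp; rewrite mdegE -prodrXr -big_split /=.
by apply: eq_bigr => i _; rewrite exprMn.
Qed.

Lemma meval_scale (n : nat) (K : comRingType) (P : 'I_n -> K) a d (p : {mpoly K[n]}) :
  p \is d.-homog -> p.@[fun i => a * P i] = a ^+ d * p.@[P].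
Proof. exact: mmap_scale. Qed.

Section Line.
Variables (K : closedFieldType) (v : 'rV[K]_3).
Local Notation S := {mpoly K[3]}.
Implicit Types (p q : S).
Hypothesis v2 : v 0 i2 != 0.

Let alpha : S := line_form v.

Lemma line_formE : alpha = v 0 i0 *: 'X_i0 + v 0 i1 *: 'X_i1 + v 0 i2 *: 'X_i2.
Proof. exact: sum_ord3. Qed.

(** Solves the equation of the line for z, which is possible when the line avoids the point
    (0:0:1). *)
Definition line_subst : S -> S := mmap (@mpolyC 3 K)
  (triple 'X_i0 'X_i1 (- (v 0 i2)^-1 *: (v 0 i0 *: 'X_i0 + v 0 i1 *: 'X_i1))).
HB.instance Definition _ := GRing.RMorphism.on line_subst.

Lemma line_form_homog : alpha \is 1.-homog.
Proof.
by apply: rpred_sum => i _; apply: rpredZ; rewrite dhomogX; apply/eqP/mdeg1.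
Qed.

Lemma line_form_neq0 : alpha != 0.
Proof.
apply: contraNneq v2 => /(congr1 (mcoeff U_(i2))).
by rewrite line_formE !mcoeffD !mcoeffZ !mcoeffXU mcoeff0 !mulr0 !add0r mulr1 => ->.
Qed.

Lemma line_subst_lr : line_restriction alpha line_subst.
Proof.
have sX i : line_subst 'X_i = triple 'X_i0 'X_i1
    (- (v 0 i2)^-1 *: (v 0 i0 *: 'X_i0 + v 0 i1 *: 'X_i1)) i by exact: mmapXU.
have sC c : line_subst c%:MP = c%:MP by exact: mmapC.
have sZ c p : line_subst (c *: p) = c *: line_subst p.
  by rewrite [LHS]mmapZ mul_mpolyC.
have h2E : v 0 i2 *: line_subst 'X_i2 = - (v 0 i0 *: 'X_i0 + v 0 i1 *: 'X_i1).
  by rewrite sX /= scalerA mulrN divff // scaleN1r.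
split; [exact: line_form_homog|exact: line_form_neq0|..] => //.
- rewrite line_formE !rmorphD /= !sZ.
  by rewrite [line_subst 'X_i0]sX [line_subst 'X_i1]sX h2E subrr.
- apply: mpoly_ind_ring.
  + by move=> c; exists 0; rewrite /= sC mulr0 addr0.
  + apply: ord3P; [exists 0|exists 0|exists (v 0 i2)^-1%:MP].
    * by rewrite /= sX mulr0 addr0.
    * by rewrite /= sX mulr0 addr0.
    * apply: (can_inj (scalerK v2)); rewrite scalerDr /= h2E mulrC mul_mpolyC scalerA.
      by rewrite divff // scale1r line_formE; ring.
  + by move=> p q [a pE] [b qE]; exists (a + b); rewrite {1}pE {1}qE rmorphD; ring.
  + move=> p q [a pE] [b qE]; exists (a * line_subst q + p * b).
    by rewrite {1}qE {1}mulrDr {1}pE rmorphM; ring.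
- move=> d p /dhomogP ph /=.
  rewrite (_ : line_subst p = \sum_(m <- msupp p) p@_m *: line_subst 'X_[m]).
    rewrite big_seq; apply: rpred_sum => m mp; apply: rpredZ.
    rewrite [line_subst _]mmapX /mmap1.
    have <- : mdeg m = d := ph m mp.
    rewrite mdegE; elim/big_rec2: _ => [|i a b _ abh]; first exact: dhomog1.
    apply: dhomogM => //; rewrite -[X in X.-homog]mul1n; apply: dhomogMn.
    elim/ord3P: i; rewrite /= ?dhomogX; do ?[by apply/eqP/mdeg1].
    by apply: rpredZ; apply: rpredD; apply: rpredZ; rewrite dhomogX; apply/eqP/mdeg1.
  by rewrite [in LHS](mpolyE p) raddf_sum; apply: eq_bigr => m _; rewrite /= sZ.
- suff : forall p, all [pred m : 'X_{1..3} | m i2 == 0%N] (msupp (line_subst p)).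
    by move=> h p m mp; apply/eqP; apply: (allP (h p)).
  pose Q q := all [pred m : 'X_{1..3} | m i2 == 0%N] (msupp q).
  have QD p q : Q p -> Q q -> Q (p + q).
    move=> /allP hp /allP hq; apply/allP => m /msuppD_le; rewrite mem_cat.
    by case/orP => [/hp|/hq].
  have QM p q : Q p -> Q q -> Q (p * q).
    move=> /allP hp /allP hq; apply/allP => m /msuppM_le /allpairsP[[a b] /= []].
    by move=> /hp /= /eqP a2 /hq /= /eqP b2 ->; rewrite mnmDE a2 b2.
  have QC c : Q c%:MP.
    apply/allP => m; rewrite msuppC; case: ifP => // _.
    by rewrite mem_seq1 => /eqP -> /=; rewrite mnm0E.
  have QX (i : 'I_3) : i != i2 -> Q 'X_i.
    by move=> i_2; rewrite /Q msuppX /= andbT mnm1E eqb0.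
  apply: mpoly_ind_ring => [c|i|p q hp hq|p q hp hq].
  + by rewrite sC; apply: QC.
  + rewrite sX; elim/ord3P: i; rewrite /triple /=; [exact: QX|exact: QX|].
    rewrite -!mul_mpolyC; apply: (QM _ _ (QC _)); apply: QD;
    by apply: (QM _ _ (QC _)); apply: QX.
  + by rewrite rmorphD; apply: QD.
  + by rewrite rmorphM; apply: QM.
Qed.

(* The point of the line with x = 'X and y = 1. *)
Definition line_point : 'I_3 -> {poly K} :=
  triple 'X 1 (- (v 0 i2)^-1 *: (v 0 i0 *: 'X + (v 0 i1)%:P)).

Definition line_eval : S -> {poly K} := mmap polyC line_point.
HB.instance Definition _ := GRing.RMorphism.on line_eval.

Lemma chart_line_subst p : chart (line_subst p) = (line_eval p)%:P.
Proof.
move: p; suff h : (chart \o line_subst) =1 (polyC \o line_eval) by [].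
apply: mpoly_rmorph_eq => [c|i] /=.
  by rewrite /line_subst /line_eval !mmapC chartC.
have chX j : chart 'X_j = triple 'X%:P 1 'X j by exact: mmapXU.
rewrite /line_subst /line_eval !mmapXU /line_point.
elim/ord3P: i; rewrite /triple /= ?chX //.
rewrite -!mul_mpolyC -!mul_polyC !rmorphM !rmorphD !rmorphM /= !chartC !chX /=.
by rewrite /triple /= mulr1.
Qed.

Lemma line_evalE p : line_eval p = (chart p).[line_point i2].
Proof.
move: p; suff h : line_eval =1 (horner_eval (line_point i2) \o chart) by [].
apply: mpoly_rmorph_eq => [c|i] /=; rewrite /horner_eval.
  by rewrite /line_eval mmapC chartC hornerC.
rewrite /line_eval mmapXU [chart _]mmapXU.
by elim/ord3P: i; rewrite /= ?hornerX ?hornerC.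
Qed.

Lemma line_eval_horner p x :
  (line_eval p).[x] = p.@[fun i => (line_point i).[x]].
Proof.
move: p; suff h : (horner_eval x \o line_eval) =1
    meval (fun i => (line_point i).[x]) by [].
apply: mpoly_rmorph_eq => [c|i] /=.
  by rewrite /line_eval mmapC /horner_eval hornerC mevalC.
by rewrite /line_eval mmapXU mevalXU.
Qed.

End Line.

Lemma bezout_triple (K : closedFieldType) (u : 'I_3 -> {poly K}) :
  (forall x, exists i, (u i).[x] != 0) -> exists c, dot c u = 1.
Proof.
move=> u0; set g := gcdp (u i0) (u i1).
have : coprimep g (u i2).
  apply/coprimepP => h hg h2; rewrite -size_poly_eq1; apply: contraTT isT => h1.
  have /closed_rootP[x hx] := h1; have [j] := u0 x.
  rewrite -dvdp_XsubCl in hx.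
  have h0 : h %| u i0 := dvdp_trans hg (dvdp_gcdl _ _).
  have h1' : h %| u i1 := dvdp_trans hg (dvdp_gcdr _ _).
  by elim/ord3P: j; rewrite -[_ == 0]/(root _ _) -dvdp_XsubCl (dvdp_trans hx).
move=> /Bezout_eq1_coprimepP[[a b] /= abE].
have [[s t] /=] := Bezoutp (u i0) (u i1); rewrite -/g eqp_sym => /eqpf_eq[k k0 gE].
exists (triple (a * k%:P * s) (a * k%:P * t) b).
by rewrite dotE /triple /= -abE gE -mul_polyC; ring.
Qed.

(** * From absence of common zeros on the line to powers of x and y in the ideal *)

Section LineCoprime.
Variables (K : closedFieldType) (v : 'rV[K]_3).
Local Notation S := {mpoly K[3]}.
Hypothesis v2 : v 0 i2 != 0.
Let alpha : S := line_form v.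
Let lr := line_subst_lr v2.
Variables (e : nat) (phi : 'I_3 -> S).
Hypothesis phi_homog : forall i, phi i \is e.-homog.
Hypothesis phi_zero : forall P : 'I_3 -> K, (exists i, P i != 0) ->
  dot (v 0) P = 0 -> exists i, (phi i).@[P] != 0.

Let I p := exists c b, p = dot c phi + alpha * b.

Lemma line_idealD p q : I p -> I q -> I (p + q).
Proof.
move=> [c [b ->]] [c' [b' ->]]; exists (fun i => c i + c' i), (b + b').
by rewrite dotDl; ring.
Qed.

Lemma line_idealM p q : I q -> I (p * q).
Proof.
by move=> [c [b ->]]; exists (fun i => p * c i), (p * b); rewrite dotZl; ring.
Qed.

(** On the affine part y = 1 of the line, [phi] becomes a triple in K[x] without common root.
    Homogenizing a Bezout relation for it turns the 1 into a power of y. *)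
Lemma line_coprime_Xi1 : exists N, I ('X_i1 ^+ N).
Proof.
have [|c cE] := @bezout_triple _ (fun i => line_eval v (phi i)).
  move=> x; pose P i := (line_point v i).[x].
  have [||i phi_i] := phi_zero (P := P).
  - by exists i1; rewrite /P /line_point /triple /= hornerC oner_eq0.
  - rewrite dotE /P /line_point /triple /=.
    rewrite !(hornerZ, hornerD, hornerC, hornerX).
    by field.
  - by exists i; rewrite line_eval_horner.
pose n := \max_(i < 3) tdeg (c i)%:P.
pose C i := homogenize n (unchart (c i)%:P).
have Ch i : C i \is n.-homog by apply: homogenize_tdeg; apply: leq_bigmax.
have CE i : line_eval v (C i) = c i.
  by rewrite line_evalE chart_homogenize unchartK hornerC.
exists (n + e)%N; pose w : S := dot C phi - 'X_i1 ^+ (n + e).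
have [|b wE] := sigma_eq0 lr (p := w).
  apply: (@chart_inj _ (n + e)).
    apply: (lr_homog lr); rewrite rpredB ?dhomogXn //.
    by rewrite dot_homog.
  rewrite /= chart_line_subst; apply/eqP; rewrite polyC_eq0; apply/eqP.
  rewrite rmorphB rmorph_dot rmorphXn /= [line_eval v 'X_i1]mmapXU expr1n.
  by rewrite (@eq_dotl _ _ c) // cE subrr.
by exists C, (- b); rewrite mulrN -wE opprB addrC subrK.
Qed.

(** The remaining point of the line is (1:0:s). Some [phi i] takes a value a != 0 there, so a x^e
    lies in the ideal modulo y, and a power of y is already in the ideal. *)
Lemma line_coprime_Xi0 : exists N, I ('X_i0 ^+ N).
Proof.
pose s := - (v 0 i2)^-1 * v 0 i0.
have [||i] := phi_zero (P := triple 1 0 s).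
- by exists i0; rewrite oner_eq0.
- by rewrite dotE /triple /= /s; field.
set a := _.@[_] => a0.
(* [theta] sends (x, y, z) to x (1, 0, s): it is reduction modulo [alpha] and y, and maps a form p
   of degree e to p(1, 0, s) x^e. *)
pose theta : {rmorphism S -> S} :=
  mmap (@mpolyC 3 K) (fun i => 'X_i0 * (triple 1 0 s i)%:MP).
have thetaE p : exists b c, p = theta p + alpha * b + 'X_i1 * c.
  have tC c : theta c%:MP = c%:MP by exact: mmapC.
  have tX j : theta 'X_j = 'X_i0 * (triple 1 0 s j)%:MP by exact: mmapXU.
  move: p; apply: mpoly_ind_ring => [c|j|p q [b [c pE]] [b' [c' qE]]|].
  + by exists 0, 0; rewrite tC; ring.
  + rewrite tX; elim/ord3P: j; rewrite /triple /=.
    * by exists 0, 0; rewrite mpolyC1; ring.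
    * by exists 0, 1; rewrite mpolyC0; ring.
    * exists ((v 0 i2)^-1%:MP), (- (v 0 i2)^-1 * v 0 i1)%:MP.
      rewrite /alpha line_formE /s -!mul_mpolyC.
      have : (v 0 i2)^-1%:MP * (v 0 i2)%:MP = 1 :> S by rewrite -mpolyCM mulVf.
      rewrite !mpolyCM mpolyCN => E.
      by rewrite -[LHS]mul1r -E; ring.
  + by exists (b + b'), (c + c'); rewrite {1}pE {1}qE rmorphD; ring.
  + move=> p q [b [c pE]] [b' [c' qE]].
    exists (b * theta q + p * b'), (c * theta q + p * c').
    transitivity (p * theta q + alpha * (p * b') + 'X_i1 * (p * c')).
      by rewrite {1}qE; ring.
    by rewrite {1}pE rmorphM; ring.
have phiE : theta (phi i) = a%:MP * 'X_i0 ^+ e.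
  rewrite /theta /= (mmap_scale _ _ _ (phi_homog i)) mulrC; congr (_ * _).
  apply: (@mpoly_rmorph_eq 3 K S (mmap (@mpolyC 3 K) (fun i => (triple 1 0 s i)%:MP))
    (@mpolyC 3 K \o meval (triple 1 0 s))) => [c|j] /=.
    by rewrite mmapC mevalC.
  by rewrite mmapXU mevalXU.
have [b [c]] := thetaE (phi i); rewrite phiE => phi_iE.
have [N IN] := line_coprime_Xi1.
have IX : I (('X_i1 * c) ^+ N) by rewrite exprMn mulrC; apply: line_idealM.
have Iphi : I (phi i).
  exists (fun j => (j == i)%:R), 0; rewrite mulr0 addr0 /dot (bigD1 i) //= eqxx mul1r.
  by rewrite big1 ?addr0 // => j /negPf ->; rewrite mul0r.
have Ialpha : I alpha by exists (fun=> 0), 1; rewrite dotE; ring.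
exists (e * N)%N; have -> : 'X_i0 ^+ (e * N) =
    (a^-1 ^+ N)%:MP * ((a%:MP * 'X_i0 ^+ e) ^+ N) :> S.
  by rewrite exprMn mulrA -rmorphXn -mpolyCM -exprMn mulVf // expr1n mpolyC1
    mul1r exprM.
apply: line_idealM; have -> : a%:MP * 'X_i0 ^+ e = (phi i - alpha * b) - 'X_i1 * c.
  by rewrite phi_iE; ring.
(* With A = a x^e and B = - y c, the power B^N is in the ideal, and A^N - B^N is a multiple of A - B
   = phi i - alpha b, which is in it too. *)
rewrite -[_ ^+ N](subrK ((- ('X_i1 * c)) ^+ N)); apply: line_idealD; last first.
  by rewrite exprNn; apply: line_idealM.
rewrite subrXX mulrC; apply: line_idealM.
have -> : phi i - alpha * b - 'X_i1 * c - - ('X_i1 * c) = phi i + (- b) * alpha by ring.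
by apply: line_idealD => //; apply: line_idealM.
Qed.

Lemma line_coprimeP : line_coprime alpha phi.
Proof.
have [M IM] := line_coprime_Xi0; have [N IN] := line_coprime_Xi1.
exists (N + M)%N; split; first by rewrite exprD; apply: line_idealM.
by rewrite exprD mulrC; apply: line_idealM.
Qed.

End LineCoprime.

(** * Finiteness of common zeros *)

Lemma closed_field_roots (K : closedFieldType) (p : {poly K}) : p != 0 ->
  {rs : seq K | forall x, root p x -> x \in rs}.
Proof.
move=> p0; have [rs pE] := closed_field_poly_normal p; exists rs => x.
by rewrite pE rootZ ?lead_coef_eq0 // root_prod_XsubC.
Qed.

Section Zeros.
Variable K : closedFieldType.
Local Notation S := {mpoly K[3]}.

Definition pt (x y z : K) : 'rV[K]_3 := \row_i triple x y z i.

Lemma ptE x y z : pt x y z 0 =1 triple x y z.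
Proof. by move=> i; rewrite mxE. Qed.

Lemma row3E (P : 'rV[K]_3) : P = pt (P 0 i0) (P 0 i1) (P 0 i2).
Proof. by apply/rowP => i; rewrite mxE; elim/ord3P: i. Qed.

Lemma pt_neq0 x y z : (pt x y z != 0) = [|| x != 0, y != 0 | z != 0].
Proof.
rewrite -!negb_and; congr (~~ _); apply/eqP/and3P => [P0|[/eqP-> /eqP-> /eqP->]].
  by split; apply/eqP; [move/rowP/(_ i0): P0|move/rowP/(_ i1): P0|move/rowP/(_ i2): P0];
    rewrite !mxE.
by apply/rowP => i; rewrite !mxE; elim/ord3P: i.
Qed.

(* The restriction to the line y = 0 in the chart x = 1. *)
Definition infinity : S -> {poly K} := mmap polyC (triple 1 0 'X).
HB.instance Definition _ := GRing.RMorphism.on infinity.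

Lemma infinity_horner p z : (infinity p).[z] = p.@[pt 1 0 z 0].
Proof.
move: p; suff h : horner_eval z \o infinity =1 meval (pt 1 0 z 0) by [].
apply: mpoly_rmorph_eq => [c|i] /=; rewrite /horner_eval.
  by rewrite [infinity _]mmapC hornerC mevalC.
rewrite [infinity _]mmapXU mevalXU ptE.
by elim/ord3P: i; rewrite /triple /= ?hornerC ?hornerX.
Qed.

Lemma fiber_horner p x z : (fiber x (chart p)).[z] = p.@[pt x 1 z 0].
Proof.
move: p; suff h : horner_eval z \o (fiber x \o chart) =1 meval (pt x 1 z 0) by [].
apply: mpoly_rmorph_eq => [c|i] /=; rewrite /horner_eval.
  by rewrite chartC fiberC hornerC hornerC mevalC.
rewrite [chart _]mmapXU mevalXU ptE.
by elim/ord3P: i; rewrite /triple /= ?fiberC ?rmorph1 ?hornerC ?hornerX //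
  /fiber map_polyX hornerX.
Qed.

Lemma infinity_eq0 p d : p \is d.-homog -> infinity p = 0 ->
  exists q, p = 'X_i1 * q.
Proof.
move=> /dhomogP ph p0; apply: (@mpolyX_dvd _ _ i1 1) => m mp.
rewrite lt0n; apply/eqP => m1.
have := congr1 (fun P : {poly K} => P`_(m i2)) p0.
rewrite coef0 [in X in X -> _](mpolyE p) raddf_sum coef_sum (bigD1_seq m) //=.
have iX m' : infinity 'X_[m'] = 0 ^+ m' i1 * 'X^(m' i2).
  rewrite /infinity mmapX /mmap1 !big_ord_recl big_ord0 /= expr1n mul1r mulr1.
  by congr (_ ^+ m' _ * _ ^+ m' _); apply/val_inj.
have iZ c q : infinity (c *: q) = c *: infinity q.
  by rewrite [LHS]mmapZ mul_polyC.
rewrite iZ iX m1 expr0 mul1r coefZ coefXn eqxx mulr1.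
rewrite big_seq_cond big1 => [|m' /andP[m'p ne_m'm]].
  by rewrite addr0 => /eqP; rewrite mcoeff_eq0 mp.
rewrite iZ iX coefZ -mulrC; have [m'1|m'1] := eqVneq (m' i1) 0%N; last first.
  by rewrite expr0n (negPf m'1) mul0r coef0 mul0r.
rewrite m'1 expr0 mul1r coefXn; have [m'2|] := eqVneq; last by rewrite mul0r.
case/eqP: ne_m'm; apply/mnmP; apply: ord3P; rewrite ?m1 ?m'1 ?m'2 //.
have /= := ph m mp; have /= := ph m' m'p.
by rewrite !mdegE !sum_ord3 m1 m'1 m'2 => <- /addIn /addIn.
Qed.

Variables (e : nat) (phi : 'I_3 -> S).
Hypothesis phi_homog : forall i, phi i \is e.-homog.
Hypothesis elim_z : exists (D : {poly K}) c,
  D != 0 /\ dot c (fun i => chart (phi i)) = D%:P.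
Hypothesis phi_fiber : forall x, exists i, fiber x (chart (phi i)) != 0.
Hypothesis phi_infinity : exists i, infinity (phi i) != 0.

(** In the chart y = 1, the coordinate x is a root of D, and z is then a root of a nonzero fiber
    over x. On y = 0 with x = 1, z is a root of a nonzero polynomial; only (0:0:1) remains. *)
Lemma finite_zeros : exists Z : seq 'rV[K]_3, (forall Q, Q \in Z -> Q != 0) /\
  forall P : 'rV[K]_3, P != 0 -> (forall i, (phi i).@[P 0] = 0) ->
  exists Q a, Q \in Z /\ P = a *: Q.
Proof.
have [D [c [D0 cE]]] := elim_z; have [rsD rsDP] := closed_field_roots D0.
have /choice[k k0] := phi_fiber; have [j j0] := phi_infinity.
pose rs x := sval (closed_field_roots (k0 x)).
have rsP x z : root (fiber x (chart (phi (k x)))) z -> z \in rs x.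
  exact: (svalP (closed_field_roots (k0 x))).
have [rsI rsIP] := closed_field_roots j0.
pose Z1 := [seq pt x 1 z | x <- rsD, z <- rs x]; pose Z2 := [seq pt 1 0 z | z <- rsI].
exists (pt 0 0 1 :: Z1 ++ Z2); split=> [Q|P P0 Pphi].
  rewrite inE mem_cat; case/or3P => [/eqP->|/allpairsPdep[x [z [_ _ ->]]]|/mapP[z _ ->]];
  by rewrite pt_neq0 oner_eq0 ?orbT.
have scale a Q : a != 0 -> P = a *: Q -> forall i, (phi i).@[Q 0] = 0.
  move=> a0 PE i; apply/eqP; have := Pphi i.
  rewrite PE (meval_eq _ (_ : _ =1 (fun j => a * Q 0 j))) => [|l]; last by rewrite mxE.
  rewrite (meval_scale _ _ (phi_homog i)) => /eqP.
  by rewrite mulf_eq0 expf_eq0 (negPf a0) andbF.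
have [y0|y0] := eqVneq (P 0 i1) 0; last first.
  pose x := P 0 i0 / P 0 i1; pose z := P 0 i2 / P 0 i1.
  have PE : P = P 0 i1 *: pt x 1 z.
    apply/rowP => i; rewrite !mxE; elim/ord3P: i; rewrite /triple /=;
    by rewrite /x /z ?mulr1 // mulrCA divff ?mulr1.
  have phi0 := scale _ _ y0 PE.
  exists (pt x 1 z), (P 0 i1); split=> //; rewrite inE mem_cat; apply/or3P/Or32.
  apply/allpairsPdep; exists x, z; split=> //.
    apply: rsDP; apply/rootP; have := congr1 (fun p => (fiber x p).[z]) cE.
    rewrite (fiberC x D) hornerC => <-.
    rewrite (raddf_sum (fiber x)) horner_sum big1 // => i _.
    by rewrite /= (rmorphM (fiber x)) hornerM fiber_horner phi0 mulr0.
  by apply: rsP; apply/rootP; rewrite fiber_horner phi0.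
have [x0|x0] := eqVneq (P 0 i0) 0.
  exists (pt 0 0 1), (P 0 i2); split; first by rewrite inE eqxx.
  rewrite {1}(row3E P) x0 y0; apply/rowP => i; rewrite !mxE.
  by elim/ord3P: i; rewrite /triple /= ?mulr0 ?mulr1.
pose z := P 0 i2 / P 0 i0.
have PE : P = P 0 i0 *: pt 1 0 z.
  apply/rowP => i; rewrite !mxE; elim/ord3P: i; rewrite /triple /=;
  by rewrite /z ?y0 ?mulr0 ?mulr1 // mulrCA divff ?mulr1.
exists (pt 1 0 z), (P 0 i0); split=> //; rewrite inE mem_cat; apply/or3P/Or33.
apply/mapP; exists z => //; apply: rsIP; apply/rootP.
by rewrite infinity_horner (scale _ _ x0 PE).
Qed.

End Zeros.

(** * Minimal syzygies *)

Lemma size_gt1_tdeg (K : fieldType) (g : {poly {poly K}}) :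
  (1 < size g)%N -> (0 < tdeg g)%N.
Proof.
move=> g1; rewrite lt0n; apply: contraTneq g1 => g0.
have /msize1_polyC gE : (msize (unchart g) <= 1)%N by rewrite /tdeg in g0; lia.
by rewrite -leqNgt -[g]unchartK gE chartC size_polyC_leq1.
Qed.

Lemma tdeg_XsubC (K : fieldType) (x : K) : tdeg ('X - x%:P)%:P = 1%N.
Proof.
rewrite /tdeg; have -> : unchart ('X - x%:P)%:P = 'X_i0 - x%:MP.
  rewrite (rmorphB polyC) unchartB.
  by congr (_ - _); [exact: unchartXC|exact: unchartC].
suff -> : msize ('X_i0 - x%:MP : {mpoly K[3]}) = 2%N by [].
apply/eqP; rewrite eqn_leq; apply/andP; split.
  rewrite (leq_trans (msizeD_le _ _)) // msizeN msizeX mdeg1 msizeC.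
  by case: (_ == _).
apply: (@leq_trans (mdeg U_(i0)).+1); first by rewrite mdeg1.
apply: msize_mdeg_lt; rewrite mcoeff_msupp mcoeffB mcoeffXU mcoeffC mnm1_eq0.
by rewrite mulr0 subr0 oner_eq0.
Qed.

Lemma homog_dvd_msize (K : fieldType) n d (p : {mpoly K[n]}) :
  p != 0 -> p \is d.-homog -> msize p = d.+1.
Proof.
move=> p0 ph; rewrite -(mlead_deg p0); congr _.+1.
by have /dhomogP /(_ _ (mlead_supp p0)) := ph.
Qed.

(** * Eliminating z, or finding a common factor *)

Section Elimination.
Variable K : closedFieldType.
Local Notation T := {poly {poly K}}.
Local Notation S := {mpoly K[3]}.

(** The alternative depends on the gcd in K(x)[z]: if it is free of z, Bezout with cleared
    denominators gives D; otherwise its primitive part divides the triple in K[x][z]. *)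
Lemma eliminate_or_factor (u : 'I_3 -> T) : (exists i, u i != 0) ->
  (exists (D : {poly K}) c, D != 0 /\ dot c u = D%:P) \/
  (exists (g : T) w, (1 < size g)%N /\ forall i, u i = g * w i).
Proof.
move=> u0; set g1 := gcdp (u i0) (u i1); set g := gcdp g1 (u i2).
have gu i : g %| u i.
  have g1u : g %| g1 by apply: dvdp_gcdl.
  elim/ord3P: i; last exact: dvdp_gcdr; apply: (dvdp_trans g1u).
    exact: dvdp_gcdl.
  exact: dvdp_gcdr.
have g0 : g != 0.
  by have [j] := u0; apply: contraNneq => g0; rewrite -dvd0p -g0.
have [g_le1|g_gt1] := leqP (size g) 1; [left|right].
  have [[s t] /= /eqpP[[c1 c2] /= /andP[c10 c20] E1]] := Bezoutp (u i0) (u i1).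
  have [[s' t'] /= /eqpP[[d1 d2] /= /andP[d10 d20] E2]] := Bezoutp g1 (u i2).
  rewrite -/g1 in E1; rewrite -/g in E2; have gE := size1_polyC g_le1.
  have k0 : g`_0 != 0 by apply: contraNneq g0 => k0; rewrite gE k0.
  (* The first Bezout relation is substituted into the second; each holds up to the nonzero factors
     c1, c2 and d1, d2 in K[x]. *)
  exists (c2 * d2 * g`_0), (triple (c1%:P * d1%:P * s' * s) (c1%:P * d1%:P * s' * t)
    (c2%:P * d1%:P * t')); split; first by rewrite !mulf_neq0.
  rewrite !polyCM -gE dotE /triple /= -[RHS]mulrA (mul_polyC d2) -E2 -!mul_polyC.
  rewrite -!mul_polyC in E1.
  have -> : c2%:P * (d1%:P * (s' * g1 + t' * u i2)) =
    d1%:P * s' * (c2%:P * g1) + c2%:P * d1%:P * t' * u i2 by ring.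
  by rewrite -E1; ring.
have [c [g' [c0 g'P gE]]] := primitive_part g0.
have /choice[w wE] : forall i, exists w, u i = g' * w.
  move=> i; have /Pdiv.Idomain.dvdpP[[k q] /= k0 kE] := gu i.
  apply: (@primitive_dvd _ _ (q * c%:P) _ k g'P k0).
  by rewrite mul_polyC kE gE; ring.
exists g', w; split=> //.
by move: g_gt1; rewrite gE mul_polyC size_scale.
Qed.

Variables (e : nat) (phi : 'I_3 -> S).
Hypothesis phi_homog : forall i, phi i \is e.-homog.
Hypothesis phi_neq0 : exists i, phi i != 0.
Hypothesis phi_nolinear : forall (L : S) U,
  L \is 1.-homog -> (forall i, phi i = L * U i) -> False.

(** Otherwise the linear polynomial vanishing at this abscissa divides the whole triple in the
    chart, and it lifts to a common linear form. *)
Lemma fiber_neq0 x : exists i, fiber x (chart (phi i)) != 0.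
Proof.
apply: contrapT => h.
have /choice[u uE] : forall i, exists u, chart (phi i) = ('X - x%:P)%:P * u.
  move=> i; apply: fiber_eq0; apply/eqP; apply: contrapT => /negP hi.
  by apply: h; exists i.
have [G [U [_ _]]] := chart_factor phi_homog phi_neq0 uE.
by rewrite tdeg_XsubC => Gh _; apply: phi_nolinear.
Qed.

Lemma infinity_neq0 : exists i, infinity (phi i) != 0.
Proof.
apply: contrapT => h.
have /choice[u uE] : forall i, exists u, phi i = 'X_i1 * u.
  move=> i; apply: (infinity_eq0 (phi_homog i)); apply/eqP.
  by apply: contrapT => /negP hi; apply: h; exists i.
by apply: phi_nolinear uE; apply: (dhomogXn _ i1 1).
Qed.

End Elimination.

Section MinimalSyzygy.
Variable K : closedFieldType.
Local Notation S := {mpoly K[3]}.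
Variables (r : nat) (rho grad : 'I_3 -> S).
Hypothesis r_gt0 : (0 < r)%N.
Hypothesis rho_homog : forall i, rho i \is r.-homog.
Hypothesis rho_neq0 : exists i, rho i != 0.
Hypothesis rho_grad : dot rho grad = 0.
Hypothesis rho_min : forall k a, (forall i, a i \is k.-homog) ->
  dot a grad = 0 -> (exists i, a i != 0) -> (r <= k)%N.

(** Dividing [rho] by a common factor would give a nonzero syzygy of smaller degree. *)
Lemma syzygy_nofactor n (G : S) U : (0 < n <= r)%N ->
  (forall i, U i \is (r - n).-homog) -> (forall i, rho i = G * U i) -> False.
Proof.
move=> nr Uh rhoE; have [i rho_i] := rho_neq0.
have [G0 U0] : G != 0 /\ U i != 0.
  by apply/andP; rewrite -negb_or -mulf_eq0 -rhoE.
have /(rho_min Uh)/(_ (ex_intro _ i U0)) : dot U grad = 0.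
  by apply: (mulfI G0); rewrite mulr0 -dotZl -[RHS]rho_grad; apply: eq_dotl.
lia.
Qed.

Lemma syzygy_nolinear (L : S) U :
  L \is 1.-homog -> (forall i, rho i = L * U i) -> False.
Proof.
move=> Lh rhoE; have [i rho_i] := rho_neq0.
have L0 : L != 0 by apply: contraNneq rho_i => L0; rewrite rhoE L0 mul0r.
apply: (@syzygy_nofactor 1 L U) => // j.
have -> : U j = hpart r 1 (U j) by apply: (dhomog_cancel L0 Lh); rewrite -rhoE.
exact: hpart_homog.
Qed.

Lemma syzygy_elim : exists (D : {poly K}) c,
  D != 0 /\ dot c (fun i => chart (rho i)) = D%:P.
Proof.
have [|//|[g [w [g1 gE]]]] := @eliminate_or_factor _ (fun i => chart (rho i)).
  have [i rho_i] := rho_neq0; exists i; apply: contraNneq rho_i => rho_i.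
  by rewrite (chart_inj (rho_homog i) rho_i).
have [G [U [gr _ _ Uh rhoE]]] := chart_factor rho_homog rho_neq0 gE.
by case: (@syzygy_nofactor (tdeg g) G U); rewrite ?gr ?size_gt1_tdeg.
Qed.

Lemma syzygy_zeros : exists Z : seq 'rV[K]_3, (forall Q, Q \in Z -> Q != 0) /\
  forall P : 'rV[K]_3, P != 0 -> (forall i, (rho i).@[P 0] = 0) ->
  exists Q a, Q \in Z /\ P = a *: Q.
Proof.
apply: (finite_zeros rho_homog syzygy_elim).
  exact: (fiber_neq0 rho_homog rho_neq0 syzygy_nolinear).
exact: (infinity_neq0 rho_homog syzygy_nolinear).
Qed.

End MinimalSyzygy.

Lemma mderiv_homog (K : fieldType) n d (p : {mpoly K[n]}) i :
  p \is d.-homog -> p^`M(i) \is d.-1.-homog.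
Proof.
move=> /dhomogP ph; apply/dhomogP => m /= mp.
have /ph /= : (m + U_(i))%MM \in msupp p.
  move: mp; rewrite !mcoeff_msupp mcoeff_deriv; apply: contra => /eqP ->.
  by rewrite mul0rn.
by rewrite mdegD mdeg1 addn1 => <-.
Qed.

Lemma euler_homog (K : fieldType) n d (p : {mpoly K[n]}) :
  p \is d.-homog -> \sum_(i < n) 'X_i * p^`M(i) = p *+ d.
Proof.
move=> /dhomogP ph.
have XE m (i : 'I_n) : 'X_i * ('X_[m])^`M(i) = (m i)%:R *: 'X_[m] :> {mpoly K[n]}.
  rewrite mderivX -scalerAr; have [->|mi] := eqVneq (m i) 0%N; first by rewrite !scale0r.
  by rewrite -mpolyXD addmC submK // lep1mP.
transitivity (\sum_(m <- msupp p) (mdeg m)%:R *: (p@_m *: 'X_[m])).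
  under eq_bigr => i _ do rewrite [X in X^`M(_)](mpolyE p) raddf_sum mulr_sumr /=.
  rewrite exchange_big /=; apply: eq_bigr => m _.
  rewrite mdegE natr_sum scaler_suml; apply: eq_bigr => i _ /=.
  by rewrite mderivZ -scalerAr XE !scalerA mulrC.
rewrite [in RHS](mpolyE p) -sumrMnl; apply: eq_big_seq => m mp.
by have /= <- := ph m mp; rewrite scaler_nat.
Qed.

(** * Reduced curves *)

Lemma chart_mderiv (K : fieldType) (p : {mpoly K[3]}) :
  chart p^`M(i2) = (chart p)^`().
Proof.
move: p; apply: mpoly_ind_ring => [c|i|p q IHp IHq|p q IHp IHq].
- by rewrite mderivC rmorph0 chartC derivC.
- rewrite mderivX -mul_mpolyC rmorphM /= chartC [chart 'X_i]mmapXU mnm1E.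
  elim/ord3P: i; rewrite /= ?derivC ?polyC0 ?mul0r //.
  by rewrite -[X in (X - _)%MM]add0m addmK chartX !mnm0E derivX !expr0 !mulr1.
- by rewrite mderivD !rmorphD /= derivD IHp IHq.
- by rewrite mderivM rmorphD !rmorphM /= derivM IHp IHq.
Qed.

Lemma deriv_neq0 (K : numFieldType) (u : {poly {poly K}}) :
  (1 < size u)%N -> u^`() != 0.
Proof.
move=> u1; apply/eqP => /(congr1 (fun p : {poly {poly K}} => p`_(size u).-2)).
have -> : (u^`())`_(size u).-2 = lead_coef u *+ (size u).-1.
  by rewrite coef_deriv lead_coefE; congr (u`_ _ *+ _); lia.
rewrite coef0 -mulr_natr => /eqP; rewrite mulf_eq0 lead_coef_eq0 -size_poly_eq0.
by rewrite -polyC_natr polyC_eq0 pnatr_eq0; case: (size u) u1 => [|[|n]].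
Qed.

Section ReducedCurve.
Variable K : numClosedFieldType.
Local Notation S := {mpoly K[3]}.
Variables (d : nat) (f : S).
Hypothesis d_gt0 : (0 < d)%N.
Hypothesis f_homog : f \is d.-homog.
Hypothesis f_reduced : reduced_poly f.

Let grad i := f^`M(i).

Let f_neq0 : f != 0. Proof. by case: f_reduced. Qed.

Lemma degree_neq0 : d%:R != 0 :> K.
Proof. by rewrite pnatr_eq0 -lt0n. Qed.

Lemma euler : f = d%:R^-1 *: dot (fun i => 'X_i) grad.
Proof.
by rewrite [dot _ _](euler_homog f_homog) -scaler_nat scalerA mulVf ?degree_neq0 ?scale1r.
Qed.

Lemma grad_homog i : grad i \is d.-1.-homog.
Proof. exact: mderiv_homog. Qed.

Lemma grad_neq0 : exists i, grad i != 0.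
Proof.
apply: contrapT => h; have : f != 0 := f_neq0.
case/eqP; rewrite euler /dot big1 ?scaler0 // => i _.
by have [->|gi] := eqVneq (grad i) 0; [rewrite mulr0|case: h; exists i].
Qed.

(** By Euler's formula f = L w. Differentiating, L divides L_i w for every i, and some derivative
    L_i is a nonzero constant; so L^2 divides f, which is reduced. *)
Lemma grad_nolinear (L : S) U :
  L \is 1.-homog -> (forall i, grad i = L * U i) -> False.
Proof.
move=> Lh gradE; pose w : S := d%:R^-1 *: dot (fun i => 'X_i) U.
have fE : f = L * w.
  rewrite {1}euler /w -scalerAr; congr (_ *: _).
  by rewrite /dot mulr_sumr; apply: eq_bigr => i _; rewrite gradE mulrCA.
have L0 : L != 0 by apply: contraNneq f_neq0 => L0; rewrite fE L0 mul0r.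
have [i Li] : exists i, L^`M(i) != 0.
  apply: contrapT => h; case/eqP: L0; rewrite -[L]mulr1n -(euler_homog Lh).
  rewrite big1 // => i _.
  by have [->|gi] := eqVneq L^`M(i) 0; [rewrite mulr0|case: h; exists i].
have /msize_poly1P[c c0 cE] : msize L^`M(i) == 1%N.
  by rewrite (homog_dvd_msize Li (mderiv_homog i Lh)).
have wE : w = L * (c^-1 *: (U i - w^`M(i))).
  have gE : grad i = c%:MP * w + L * w^`M(i) by rewrite /grad fE mderivM cE.
  by rewrite -scalerAr mulrBr -gradE gE addrK mul_mpolyC scalerA mulVf // scale1r.
have [_ /(_ L (c^-1 *: (U i - w^`M(i))))] := f_reduced.
rewrite expr2 -mulrA -wE => /(_ fE).
by rewrite (homog_dvd_msize L0 Lh).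
Qed.

(** In characteristic 0 it suffices to exclude square factors of positive degree in z. By Gauss such
    a factor may be taken primitive with its square dividing in K[x][z]; two liftings then give a
    square dividing f. *)
Lemma chart_separable : separable_poly (chart f).
Proof.
have chart_f0 : chart f != 0.
  by apply: contraNneq f_neq0 => /(chart_inj f_homog) ->.
apply/separable_polyP; split=> [|u _ u1]; last exact: deriv_neq0.
apply/poly_square_freeP => u u1; apply/negP.
move=> /Pdiv.Idomain.dvdpP[[k q] /= k0 kE].
have u0 : u != 0.
  apply/eqP => u0; move/eqP: kE; rewrite u0 expr0n mulr0 -mul_polyC mulf_eq0.
  by rewrite polyC_eq0 (negPf k0) (negPf chart_f0).
have [c [g [c0 gP uE]]] := primitive_part u0.
have g1 : (1 < size g)%N.
  have <- : size u = size g by rewrite uE mul_polyC size_scale.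
  by move: u1 u0; rewrite -size_poly_eq0; case: (size u) => [|[|n]].
have [w fE] : exists w, chart f = g * (g * w).
  have ggP : primitive (g * g) by move=> a; rewrite rmorphM mulf_neq0 ?gP.
  have [|w wE] := @primitive_dvd _ _ (q * (c * c)%:P) (chart f) k ggP k0.
    by rewrite mul_polyC kE uE polyCM; ring.
  by exists w; rewrite mulrA.
have f0 : exists i : unit, f != 0 by exists tt.
have [G [U [_ Gg Gh Uh fGU]]] :=
  @chart_factor _ _ d (fun=> f) g (fun=> g * w) (fun=> f_homog) f0 (fun=> fE).
have g0 : g != 0 by apply: contraTneq g1 => ->; rewrite size_poly0.
have Ug : chart (U tt) = g * w.
  by apply: (mulfI g0); rewrite -[in LHS]Gg -rmorphM -fGU.
have U0 : exists i : unit, U tt != 0.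
  by exists tt; apply: contraNneq f_neq0 => U0; rewrite (fGU tt) U0 mulr0.
have [G' [W [_ Gg' Gh' _ UGW]]] :=
  @chart_factor _ unit _ (fun=> U tt) g (fun=> w) (fun=> Uh tt) U0 (fun=> Ug).
(* Both lifts have degree [tdeg g] and the same image in the chart. *)
have GG' : G' = G.
  by apply: (chart_homog_inj Gh' Gh); rewrite Gg' Gg.
have [_ /(_ G (W tt))] := f_reduced.
have -> : f = G ^+ 2 * W tt by rewrite expr2 -mulrA -{2}GG' -UGW -fGU.
move=> /(_ erefl) /msize1_polyC GE.
by move: g1; rewrite -Gg GE chartC ltnNge size_polyC_leq1.
Qed.

(** Separability gives a Bezout relation between [chart f] and its z-derivative. The derivative is a
    component of the gradient, and Euler's formula expresses [chart f] through the gradient. *)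
Lemma grad_elim : exists (D : {poly K}) c,
  D != 0 /\ dot c (fun i => chart (grad i)) = D%:P.
Proof.
move: chart_separable; rewrite separable_poly.unlock.
move=> /Bezout_coprimepP[[a b] /= /eqpP[[c1 c2] /= /andP[c10 c20] E]].
exists c2, (fun i => c1%:P * a * ((d%:R^-1)%:P%:P * chart 'X_i) +
  (i == i2)%:R * (c1%:P * b)); split=> //.
rewrite -[RHS]mulr1 [RHS]mul_polyC -E -mul_polyC mulrDr -chart_mderiv.
rewrite dotDl; congr (_ + _); last first.
  rewrite /dot (bigD1 i2) // eqxx mul1r mulrA big1 /= ?addr0 // => i /negPf ->.
  by rewrite !mul0r.
rewrite dotZl mulrA; congr (_ * _); rewrite dotZl.
rewrite [in RHS]euler chartZ; congr (_ * _).
by rewrite chart_dot.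
Qed.

Lemma grad_zeros : exists Z : seq 'rV[K]_3, (forall Q, Q \in Z -> Q != 0) /\
  forall P : 'rV[K]_3, P != 0 -> (forall i, (grad i).@[P 0] = 0) ->
  exists Q a, Q \in Z /\ P = a *: Q.
Proof.
apply: (finite_zeros grad_homog grad_elim).
  exact: (fiber_neq0 grad_homog grad_neq0 grad_nolinear).
exact: (infinity_neq0 grad_homog grad_nolinear).
Qed.

End ReducedCurve.

(** * The Jacobian module *)

Lemma mnm_split n k (m : 'X_{1..n}) : (k <= mdeg m)%N ->
  exists m1 m2 : 'X_{1..n}, mdeg m1 = k /\ m = (m1 + m2)%MM.
Proof.
elim: k => [|k IH] km; first by exists 0%MM, m; rewrite mdeg0 add0m.
have [m1 [m2 [m1k mE]]] := IH (ltnW km).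
have [j m2j] : exists j, m2 j != 0%N.
  apply: contrapT => h; move: km; rewrite mE mdegD m1k (_ : mdeg m2 = 0%N) ?addn0 ?ltnn //.
  rewrite mdegE big1 // => j _; apply/eqP; apply: contrapT => /negP hj.
  by apply: h; exists j.
exists (m1 + U_(j))%MM, (m2 - U_(j))%MM; split; first by rewrite mdegD m1k mdeg1 addn1.
by rewrite mE -addmA [(U_(j) + _)%MM]addmC submK // lep1mP.
Qed.

Section JacobianModule.
Variable K : closedFieldType.
Local Notation S := {mpoly K[3]}.
Variable f : S.
Let grad i := f^`M(i).

Lemma jacobian_idealE g : (g \in jacobian_ideal f) <-> exists a, g = dot a grad.
Proof. by split=> [/asboolP|h]; last exact/asboolP. Qed.

Lemma jacobian_idealD g h :
  g \in jacobian_ideal f -> h \in jacobian_ideal f -> g + h \in jacobian_ideal f.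
Proof.
move=> /jacobian_idealE[a ->] /jacobian_idealE[b ->]; apply/jacobian_idealE.
by exists (fun i => a i + b i); rewrite dotDl.
Qed.

Lemma jacobian_idealM g h : h \in jacobian_ideal f -> g * h \in jacobian_ideal f.
Proof.
move=> /jacobian_idealE[a ->]; apply/jacobian_idealE.
by exists (fun i => g * a i); rewrite dotZl.
Qed.

Variables (v : 'rV[K]_3) (e : nat).
Hypothesis v2 : v 0 i2 != 0.
Hypothesis grad_homog : forall i, grad i \is e.-homog.
Let alpha := line_form v.
Hypothesis grad_coprime : line_coprime alpha grad.

(** Saturating with respect to [alpha] alone suffices, because the gradient and [alpha] generate a
    power of (x, y, z). *)
Lemma mem_jacobian_satP g :
  (g \in jacobian_sat f) <-> exists k, exists a, alpha ^+ k * g = dot a grad.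
Proof.
split=> [/asboolP[k gk]|[k gk]].
  exists k; apply/jacobian_idealE.
  have /dhomogP alphak : alpha ^+ k \is k.-homog.
    by rewrite -[X in X.-homog]mul1n dhomogMn ?line_form_homog.
  rewrite [alpha ^+ k]mpolyE mulr_suml big_seq.
  elim/big_rec: _ => [|m p mk IH].
    by apply/jacobian_idealE; exists (fun=> 0); rewrite dotE; ring.
  apply: jacobian_idealD IH; rewrite -mul_mpolyC -mulrA.
  by apply: jacobian_idealM; apply: gk; exact: alphak.
have [N NE] := monomials_in_ideal (line_subst_lr v2) grad_coprime.
suff step h : alpha * h \in jacobian_sat f -> h \in jacobian_sat f.
  elim: k g gk => [|k IH] g gk.
    apply/asboolP; exists 0%N => m _; apply: jacobian_idealM.
    by apply/jacobian_idealE; move: gk; rewrite expr0 mul1r.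
  by apply/step/IH; rewrite mulrA -exprSr.
move=> /asboolP[l hl]; apply/asboolP; exists (l + N)%N => m mE.
have [|m1 [m2 [m1E mE']]] := @mnm_split _ l m; first by rewrite mE leq_addr.
(* In m1 m2 h, the factor m2 is replaced by c.grad + alpha b: the first term lands in the Jacobian
   ideal, the second is a multiple of m1 (alpha h). *)
have [|c [b m2E]] := NE m2.
  by apply/eqP; rewrite -(eqn_add2l l) -{1}m1E -mdegD -mE' mE.
rewrite mE' mpolyXD m2E -mulrA mulrDl mulrDr; apply: jacobian_idealD.
  rewrite mulrA mulrAC; apply: jacobian_idealM.
  by apply/jacobian_idealE; exists c.
have -> : 'X_[m1] * (alpha * b * h) = b * ('X_[m1] * (alpha * h)) by ring.
by apply: jacobian_idealM; apply: hl.
Qed.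

Variables (r : nat) (rho : 'I_3 -> S).
Hypothesis rho_homog : forall i, rho i \is r.-homog.
Hypothesis rho_grad : dot rho grad = 0.
Hypothesis rho_coprime : line_coprime alpha rho.
Hypothesis r_gt0 : (0 < r)%N.
Hypothesis lt_re : (r < e)%N.

Let lr := line_subst_lr v2.

Lemma lefschetz_inj_iter j p g : (p + j + r < 2 * e)%N -> g \is p.-homog ->
  alpha ^+ j * g \in jacobian_ideal f -> g \in jacobian_ideal f.
Proof.
elim: j p g => [|j IH] p g lt_pj gh; first by rewrite expr0 mul1r.
rewrite exprSr -mulrA => gJ.
have agh : alpha * g \is p.+1.-homog.
  exact: (dhomogM (line_form_homog v) gh).
have /jacobian_idealE agJ : alpha * g \in jacobian_ideal f.
  by apply: (IH p.+1) gJ => //; lia.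
apply/jacobian_idealE.
apply: (lefschetz_inj lr rho_homog grad_homog rho_grad rho_coprime grad_coprime
  lt_re _ agh agJ).
lia.
Qed.

(** One factor [alpha] is extracted at a time. The strictest bound is that of the last extraction,
    from degree p + 1 to degree p. *)
Lemma lefschetz_surj_iter j p g : (e + r <= p.+2)%N -> g \is (p + j).-homog ->
  g \in jacobian_sat f -> exists g' : S, [/\ g' \is p.-homog,
    g' \in jacobian_sat f & g - alpha ^+ j * g' \in jacobian_ideal f].
Proof.
move=> le_p; elim: j g => [|j IH] g gh gsat.
  exists g; split=> //; first by rewrite addn0 in gh.
  by apply/jacobian_idealE; exists (fun=> 0); rewrite dotE; ring.
have [k gk] := (mem_jacobian_satP g).1 gsat.
have [|g1 [g1h g1sat gg1]] := lefschetz_surj lr rho_homog grad_homog rho_grad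
  rho_coprime grad_coprime lt_re r_gt0 _ gh gk; first by lia.
rewrite addnS /= in g1h.
have [||g' [g'h g'sat g1g']] := IH g1; first exact: g1h.
  by apply/mem_jacobian_satP; exists k.+1.
exists g'; split=> //.
have -> : g - alpha ^+ j.+1 * g' = (g - alpha * g1) + alpha * (g1 - alpha ^+ j * g').
  by rewrite exprS; ring.
apply: jacobian_idealD; last exact: jacobian_idealM.
by apply/jacobian_idealE; have [a gE] := gg1; exists a; rewrite gE addrC addKr.
Qed.

Lemma lefschetz_bij p q : (e + r <= p.+2)%N -> (p <= q)%N -> (q + r < 2 * e)%N ->
  set_bij (jacobian_piece f p) (jacobian_piece f q)
    (fun n : jacobian_module f => alpha ^+ (q - p) *: n).
Proof.
move=> le_p le_pq lt_q; set j := (q - p)%N; have qE : q = (p + j)%N by rewrite /j; lia.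
pose pi (g : jacobian_sat_module f) : jacobian_module f :=
  \pi_(lmod_quot (jacobian_in_sat f))%qT g.
have piZ a g : a *: pi g = pi (a *: g) by rewrite /pi lmod_quot_piZ.
have piP g h : pi g = pi h <-> val g - val h \in jacobian_ideal f.
  exact: lmod_quot_piP.
split.
- move=> _ [g gh ->]; exists (alpha ^+ j *: g); last exact: piZ.
  rewrite qE addnC; apply: dhomogM => //.
  by rewrite -[X in X.-homog]mul1n dhomogMn ?line_form_homog.
- move=> _ _ /set_mem[g gh ->] /set_mem[h hh ->].
  rewrite -!/(pi _) !piZ => /piP E; apply/piP.
  apply: (@lefschetz_inj_iter j p); [lia|exact: rpredB|].
  by rewrite mulrBr.
- move=> _ [g gh ->]; rewrite qE in gh.
  have [g' [g'h g'sat E]] := lefschetz_surj_iter le_p gh (valP g).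
  exists (pi (Sub g' g'sat)); first by exists (Sub g' g'sat); rewrite ?SubK.
  by rewrite piZ; apply/esym/piP.
Qed.

End JacobianModule.

(** * Generic lines *)

Section GenericLine.
Variable K : closedFieldType.
Local Notation S := {mpoly K[3]}.

Lemma meval_line_form (Q v : 'rV[K]_3) : (line_form Q).@[v 0] = dot (v 0) (Q 0).
Proof.
rewrite rmorph_sum; apply: eq_bigr => i _ /=.
by rewrite mevalZ mevalXU mulrC.
Qed.

(** A common zero on the line would be proportional to a point of [Z], and the line contains none of
    them. *)
Lemma line_coprime_avoid (Z : seq 'rV[K]_3) (v : 'rV[K]_3) e (phi : 'I_3 -> S) :
  v 0 i2 != 0 -> (forall i, phi i \is e.-homog) ->
  (forall P : 'rV[K]_3, P != 0 -> (forall i, (phi i).@[P 0] = 0) ->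
     exists Q a, Q \in Z /\ P = a *: Q) ->
  (forall Q, Q \in Z -> dot (v 0) (Q 0) != 0) -> line_coprime (line_form v) phi.
Proof.
move=> v2 phih ZP vZ; apply: (line_coprimeP v2 phih) => P [l Pl] vP.
apply: contrapT => h; pose P' : 'rV[K]_3 := \row_j P j.
have P'E : P' 0 =1 P by move=> j; rewrite mxE.
have P'0 : P' != 0.
  by apply: contraNneq Pl => P'0; rewrite -P'E P'0 mxE.
have [j|Q [a [QZ PE]]] := ZP P' P'0.
  rewrite (meval_eq _ P'E); apply/eqP; apply: contrapT => /negP hj.
  by apply: h; exists j.
have : a * dot (v 0) (Q 0) = 0.
  rewrite -vP -(eq_dotr _ P'E) dotC -dotZl dotC; apply: eq_dotr => j.
  by rewrite PE mxE.
move/eqP; rewrite mulf_eq0 (negPf (vZ Q QZ)) orbF => /eqP a0.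
by case/eqP: P'0; rewrite PE a0 scale0r.
Qed.

(** The lines through a given point Q form a line in the dual plane with equation [line_form Q]; the
    product over [Z] defines the complement of the required open set. *)
Lemma for_generic_lineP (Z : seq 'rV[K]_3) (P : S -> Prop) :
  (forall Q, Q \in Z -> Q != 0) ->
  (forall v : 'rV[K]_3, (forall Q, Q \in Z -> dot (v 0) (Q 0) != 0) -> P (line_form v)) ->
  for_generic_line P.
Proof.
move=> Z0 PZ; pose G : S := \prod_(Q <- Z) line_form Q.
have GE (v : 'rV[K]_3) : G.@[v 0] = \prod_(Q <- Z) dot (v 0) (Q 0).
  by rewrite rmorph_prod; apply: eq_bigr => Q _; rewrite /= meval_line_form.
exists [set v : 'rV[K]_3 | v != 0 /\ exists2 H, [set G]%classic H & H.@[v 0] != 0]%classic.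
split.
- exists [set G]%classic; split=> // H ->; exists (size Z); rewrite /G.
  elim: (Z) => [|Q s IH]; first by rewrite big_nil dhomog1.
  by rewrite big_cons; exact: (dhomogM (line_form_homog Q) IH).
- (* The moment curve (1, t, t^2) meets each of the finitely many excluded
     planes in finitely many points. *)
  pose q (Q : 'rV[K]_3) : {poly K} := (Q 0 i0)%:P + (Q 0 i1)%:P * 'X + (Q 0 i2)%:P * 'X^2.
  have [|t] := elimT (@closed_nonrootP _ (\prod_(Q <- Z) q Q)) _.
    rewrite prodf_seq_neq0; apply/allP => Q /Z0; apply: contraNneq => qQ /=.
    apply/eqP/rowP; have co k : (q Q)`_k = 0 by rewrite qQ coef0.
    move: (co 0%N) (co 1%N) (co 2%N); rewrite /q !coefD !coefCM !coefC !coefX !coefXn /=.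
    rewrite !(mulr0, mulr1, addr0, add0r) => c0 c1 c2.
    by apply: ord3P; rewrite mxE.
  rewrite -[root _ _]/(_ == 0) horner_prod => tZ.
  exists (pt 1 t (t ^+ 2)); split; first by rewrite pt_neq0 oner_eq0.
  exists G => //; rewrite GE; apply: contraNneq tZ => <-.
  apply/eqP; apply: eq_bigr => Q _; rewrite dotE !ptE /triple /=.
  by rewrite /q !(hornerD, hornerM, hornerC, hornerX, hornerXn); ring.
- move=> v [v0 [_ -> Gv]]; apply: PZ => Q QZ; move: Gv; rewrite GE.
  by rewrite prodf_seq_neq0 => /allP /(_ Q QZ).
Qed.

End GenericLine.

(** * The isomorphism for a generic line *)

Theorem corollary3p3 (R : realType) (d r : nat) (f : {mpoly R[i][3]})
    (f_homog : f \is d.-homog) (f_reduced : reduced_poly f)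
    (f_mdr : is_mdr f r) (r_ge1 : (1 <= r)%N) (r_lt : (2 * r < d)%N) :
  for_generic_line (fun alpha : {mpoly R[i][3]} =>
    forall p q : nat,
      (d + r - 3 <= p)%N -> (p < q)%N -> (q <= 2 * d - r - 3)%N ->
      set_bij (jacobian_piece f p) (jacobian_piece f q)
        (fun n : jacobian_module f => alpha ^+ (q - p) *: n)).
Proof.
have [[rho [rho_homog rho_grad] rho_neq0] rho_min] := f_mdr.
have d_gt0 : (0 < d)%N by lia.
have gradh := grad_homog f_homog.
have [|Zr [Zr0 ZrP]] := @syzygy_zeros _ r rho (fun i => f^`M(i)) r_ge1 rho_homog rho_neq0 rho_grad.
- by move=> k a ah agrad a0; apply: rho_min; exists a.
have [Zf [Zf0 ZfP]] := grad_zeros d_gt0 f_homog f_reduced.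
(* Avoiding (0:0:1) as well makes the coefficient of z in the equation of the line nonzero, so z can
   be eliminated. *)
apply: (@for_generic_lineP _ (pt 0 0 1 :: Zr ++ Zf)) => [Q|v vZ].
  rewrite inE mem_cat; case/or3P => [/eqP->|/Zr0|/Zf0] //.
  by rewrite pt_neq0 oner_eq0 !orbT.
have v2 : v 0 i2 != 0.
  have := vZ _ (mem_head _ _); rewrite dotE !ptE /triple /=.
  by rewrite !mulr0 !add0r mulr1.
have rho_coprime : line_coprime (line_form v) rho.
  apply: (line_coprime_avoid v2 rho_homog ZrP) => Q QZ.
  by apply: vZ; rewrite inE mem_cat QZ orbT.
have grad_coprime : line_coprime (line_form v) (fun i => f^`M(i)).
  apply: (line_coprime_avoid v2 gradh ZfP) => Q QZ.
  by apply: vZ; rewrite inE mem_cat QZ !orbT.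
move=> p q le_p lt_pq le_q.
(* With e = d - 1, the bounds e + r <= p + 2 and q + r < 2e read d + r - 3 <= p and q <= 2d - r - 3,
   and r < e follows from 2r < d and r >= 1. *)
by apply: (lefschetz_bij v2 gradh grad_coprime rho_homog rho_grad rho_coprime r_ge1); lia.
Qed.
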